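(* Consider a Borel-state MDP $(\mathbb{X},\mathbb{A},A(\cdot),c,q)$ with transition probabilities $q$ (i.e. $q(\mathbb{X}|x,a)=1$ for all $(x,a)\in\mathrm{Gr}(A)$) satisfying Assumption S. Suppose $c$ is bounded and there are a state $\ell\in\mathbb{X}$ and a constant $K^*<\infty$ with $\|\sum_{n=0}^\infty{}_\ell Q_\phi^n\|\le K^*$ for all $\phi\in\mathbb{F}$. Let $\mu:\mathbb{X}\to[1,\infty)$ be a Borel-measurable function with $\mu\le K^*$ and $\mu(x)\ge1+\int_{\mathbb{X}\setminus\{\ell\}}\mu(y)\,q(dy|x,a)$ for all $(x,a)\in\mathrm{Gr}(A)$, let $\bar\beta\in[\frac{K^*-1}{K^*},1)$, and let $\bar v_{\bar\beta}$ be the value function of the discounted MDP defined by the HV-AG transformation. Then: (i) the constant $w=\bar v_{\bar\beta}(\ell)$ and the function $h(x)=\mu(x)[\bar v_{\bar\beta}(x)-\bar v_{\bar\beta}(\ell)]$, $x\in\mathbb{X}$, satisfy the optimality equation $$w+h(x)=\min_{a\in A(x)}\Big[c(x,a)+\int_{\mathbb{X}}h(y)\,q(dy|x,a)\Big],\quad x\in\mathbb{X},$$ and $\bar v_{\bar\beta}(\ell)$ is the optimal average cost for each initial state, i.e. $\inf_{\phi\in\mathbb{F}}w^\phi(x)=\bar v_{\bar\beta}(\ell)$ for all $x\in\mathbb{X}$; (ii) with these $w$ and $h$, let $A^*_{\mathrm{av}}(x):=\{a\in A(x): w+h(x)=c(x,a)+\int_{\mathbb{X}}h(y)\,q(dy|x,a)\}$.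 There is a $\phi\in\mathbb{F}$ satisfying $\phi(x)\in A^*_{\mathrm{av}}(x)$ for all $x\in\mathbb{X}$, where $$A^*_{\mathrm{av}}(x)=\Big\{a\in A(x):\ \bar v_{\bar\beta}(x)=\bar c(x,a)+\bar\beta\int_{\bar{\mathbb{X}}}\bar v_{\bar\beta}(y)\,\bar p(dy|x,a)\Big\},\quad x\in\mathbb{X},$$ and any such policy is average-cost optimal.
   Context: Borel-state MDP: $\mathbb{X}$ and $\mathbb{A}$ are Borel subsets of complete separable metric spaces (states, actions); for each $x\in\mathbb{X}$, $A(x)$ is a nonempty Borel subset of $\mathbb{A}$; $\mathrm{Gr}(A):=\{(x,a):x\in\mathbb{X},a\in A(x)\}$ is a Borel subset of $\mathbb{X}\times\mathbb{A}$; $c:\mathrm{Gr}(A)\to\mathbb{R}$ is Borel measurable; the transition rates are given by a kernel $q$: $q(\cdot|x,a)$ is a finite measure on $\mathbb{X}$ for each $(x,a)\in\mathrm{Gr}(A)$, and $q(B|\cdot)$ is Borel measurable on $\mathrm{Gr}(A)$ for each Borel $B\subseteq\mathbb{X}$. A stationary policy is a Borel-measurable $\phi:\mathbb{X}\to\mathbb{A}$ with $\phi(x)\in A(x)$ for all $x$; $\mathbb{F}$ is the set of all of them. $Q_\phi u(x):=\int_{\mathbb{X}}u(y)\,q(dy|x,\phi(x))$, ${}_\ell Q_\phi u(x):=\int_{\mathbb{X}\setminus\{\ell\}}u(y)\,q(dy|x,\phi(x))$; $Q_\phi^n$, ${}_\ell Q_\phi^n$ are the $n$-th iterates (also viewed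 as kernels); $c_\phi(x):=c(x,\phi(x))$. For a kernel $B$ on $\mathbb{X}$ given $\mathbb{X}$, $\|B\|:=\sup_xB(\mathbb{X}|x)$. Average cost: $w^\phi(x):=\limsup_{N\to\infty}\frac1N\sum_{n=0}^{N-1}Q_\phi^nc_\phi(x)$; $\phi_*\in\mathbb{F}$ is average-cost optimal if $w^{\phi_*}(x)=\inf_{\phi\in\mathbb{F}}w^\phi(x)$ for all $x\in\mathbb{X}$. Assumption S: (a) $A(x)$ is compact and $c(x,a)$ is lower semicontinuous in $a\in A(x)$, for each $x\in\mathbb{X}$; (b) for every $x\in\mathbb{X}$, if a sequence $\{a_n\}$ in $A(x)$ converges to $a\in A(x)$, then $q(B|x,a_n)\to q(B|x,a)$ for every Borel $B\subseteq\mathbb{X}$. HV-AG transformation (given $\ell,K^*,\mu,\bar\beta$ as in the claim; under the claim's hypotheses such a $\mu$ exists): state space $\bar{\mathbb{X}}:=\mathbb{X}\cup\{\bar x\}$ where $\bar x\notin\mathbb{X}$ is isolated from $\mathbb{X}$, action space $\mathbb{A}\cup\{\bar a\}$, action sets $\bar A(x):=A(x)$ for $x\in\mathbb{X}$ and $\bar A(\bar x):=\{\bar a\}$; costs $\bar c(x,a):=\mu(x)^{-1}c(x,a)$ on $\mathrm{Gr}(A)$ and $\bar c(\bar x,\bar a):=0$; transition probabilities, for $(x,a)\in\mathrm{Gr}(A)$: $\bar p(B|x,a):=\frac1{\bar\beta\mu(x)}\int_B\mu(y)\,q(dy|x,a)$ for Borel $B\subseteq\mathbb{X}\setminus\{\ell\}$,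 $\bar p(\{\ell\}|x,a):=\frac1{\bar\beta\mu(x)}[\mu(x)-1-\int_{\mathbb{X}\setminus\{\ell\}}\mu(y)\,q(dy|x,a)]$, $\bar p(\{\bar x\}|x,a):=1-\frac1{\bar\beta\mu(x)}[\mu(x)-1]$, and $\bar p(\{\bar x\}|\bar x,\bar a):=1$. (If $\bar\beta=0$, which forces $K^*=1$, all the numerators vanish and quotients $0/0$ are read as $0$.) Policies are extended by $\phi(\bar x):=\bar a$. With $\bar P_\phi u(x):=\int_{\bar{\mathbb{X}}}u(y)\,\bar p(dy|x,\phi(x))$ and $\bar c_\phi(x):=\bar c(x,\phi(x))$, $\bar v^\phi_{\bar\beta}(x):=\sum_{n=0}^\infty\bar\beta^n\bar P_\phi^n\bar c_\phi(x)$ (with $0^0=1$) and $\bar v_{\bar\beta}(x):=\inf_{\phi\in\mathbb{F}}\bar v^\phi_{\bar\beta}(x)$, $x\in\bar{\mathbb{X}}$. *)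

(* Defs.v *)
From HB Require Import structures.
From mathcomp Require Import all_boot all_order all_algebra.
From mathcomp Require Import all_classical all_reals all_analysis.
From mathcomp Require Import measurable_realfun.

Set Implicit Arguments.
Unset Strict Implicit.
Unset Printing Implicit Defensive.
Import Order.TTheory GRing.Theory Num.Theory.
Import numFieldNormedType.Exports.

Local Open Scope classical_set_scope.
Local Open Scope ring_scope.
Local Open Scope ereal_scope.

#[short(type="completeMetricType")]
HB.structure Definition CompleteMetric (R : numDomainType) :=
  { T of CompletePseudoMetric R T & Metric R T }.

Definition separable (T : topologicalType) :=
  exists2 D : set T, countable D & dense D.

Notation borel T := (g_sigma_algebraType (@open T)).

(* Topology of the disjoint union of T and an isolated point None. *)
Definition open_option (T : topologicalType) : set (set (option T)) :=
  [set B | open (Some @^-1` B)].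

Notation borel_option T := (g_sigma_algebraType (@open_option T)).

Definition action_graph (R : realType) (S T : completeMetricType R)
    (X : set S) (A : S -> set T) :
    set (borel S * borel T) := [set xa | X xa.1 /\ A xa.1 xa.2].

(* Borel-state MDP; S and T are the ambient spaces of the states and of the
   actions.  The functions cost and trans are total, but they are constrained,
   and used, on the graph of the action sets only.  A measure on the Borel
   subset states of S is represented by a measure on S that gives mass 0 to the
   complement of states. *)
Record borel_mdp (R : realType) (S T : completeMetricType R) := BorelMDP {
  states : set S ;
  actions : set T ;
  act : S -> set T ;
  cost : S -> T -> R ;
  trans : S -> T -> {measure set (borel S) -> \bar R} ;
  separable_states : separable S ;
  separable_actions : separable T ;
  measurable_states : measurable (states : set (borel S)) ;
  measurable_actions : measurable (actions : set (borel T)) ;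
  act_sub : forall x, states x -> act x `<=` actions ;
  act_neq0 : forall x, states x -> act x !=set0 ;
  measurable_act : forall x, states x -> measurable (act x : set (borel T)) ;
  measurable_graph : measurable (action_graph states act) ;
  measurable_cost : measurable_fun (action_graph states act)
    (fun xa => cost xa.1 xa.2) ;
  trans_fin : forall x a, states x -> act x a -> trans x a states < +oo ;
  trans_out : forall x a, states x -> act x a -> trans x a (~` states) = 0 ;
  measurable_trans : forall B : set (borel S), measurable B ->
    measurable_fun (action_graph states act) (fun xa => trans xa.1 xa.2 B) }.

Section mdp.
Context (R : realType) (S T : completeMetricType R) (M : borel_mdp S T).
Local Notation X := (@states R S T M).
Local Notation A := (@act R S T M).
Local Notation c := (@cost R S T M).
Local Notation q := (@trans R S T M).

(* Only the values of a policy on the states matter. *)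
Definition policies : set (S -> T) :=
  [set phi | measurable_fun (X : set (borel S)) (phi : borel S -> borel T)
    /\ forall x, X x -> A x (phi x)].

Definition transition_probabilities :=
  forall x a, X x -> A x a -> q x a X = 1.

Definition bounded_cost :=
  exists C : R, forall x a, X x -> A x a -> (`|c x a| <= C)%R.

Definition assumptionS :=
  (forall x, X x -> compact (A x) /\
    @lower_semicontinuous (subspace (A x)) R (fun a => (c x a)%:E)) /\
  (forall x, X x -> forall (a_ : nat -> T) (a : T),
    (forall n, A x (a_ n)) -> A x a -> a_ @ \oo --> a ->
    forall B : set (borel S), measurable B ->
      (fun n => q x (a_ n) B) @ \oo --> q x a B).

Definition op (phi : S -> T) (u : S -> \bar R) (x : S) : \bar R :=
  \int[q x (phi x)]_(y in X) u y.

Definition taboo_op (l : S) (phi : S -> T) (u : S -> \bar R) (x : S) : \bar R :=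
  \int[q x (phi x)]_(y in X `\ l) u y.

Definition taboo_kernel (l : S) (phi : S -> T) (n : nat) (x : S) (B : set S) :
    \bar R :=
  iter n (taboo_op l phi) (fun y => (\1_B y)%:E) x.

Definition kernel_norm (k : S -> set S -> \bar R) : \bar R :=
  ereal_sup [set k x X | x in X].

Definition cost_of (phi : S -> T) (x : S) : \bar R := (c x (phi x))%:E.

(* The term of index N = 0 is 0; it does not affect the upper limit. *)
Definition avg_cost (phi : S -> T) (x : S) : \bar R :=
  limn_esup (fun N : nat =>
    (N%:R^-1)%:E * \sum_(0 <= n < N) iter n (op phi) (cost_of phi) x).

Definition opt_avg_cost (x : S) : \bar R :=
  ereal_inf [set avg_cost phi x | phi in policies].

Definition avg_optimal (phi : S -> T) :=
  policies phi /\ forall x, X x -> avg_cost phi x = opt_avg_cost x.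

Definition avg_rhs (h : S -> \bar R) (x : S) (a : T) : \bar R :=
  (c x a)%:E + \int[q x a]_(y in X) h y.

Definition avg_argmin (w : \bar R) (h : S -> \bar R) (x : S) : set T :=
  [set a | A x a /\ w + h x = avg_rhs h x a].

(* Discounted MDP of the HV-AG transformation: None is both the additional state
   and its only action, and a policy phi is extended by omap phi. *)
Section hvag.
Variables (l : S) (mu : S -> R) (beta : R).

Definition hvag_states : set (option S) := Some @` X `|` [set None].

Definition hvag_cost (x : option S) (a : option T) : R :=
  match x, a with
  | Some x, Some a => (mu x)^-1 * c x a
  | _, _ => 0
  end%R.

(* A Borel set B is split into its traces on states `\ l, {l} and {None}.  In
   case beta = 0, (beta * mu x)^-1 = 0. *)
Definition hvag_trans (x : option S) (a : option T)
    (B : set (borel_option S)) : \bar R :=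
  match x, a with
  | Some x, Some a =>
      ((beta * mu x)^-1)%:E *
        \int[q x a]_(y in [set y | B (Some y)] `&` (X `\ l)) (mu y)%:E
    + ((beta * mu x)^-1)%:E *
        ((mu x - 1)%:E - \int[q x a]_(y in X `\ l) (mu y)%:E) * \d_(Some l : borel_option S) B
    + (1 - (beta * mu x)^-1 * (mu x - 1))%:E * \d_(None : borel_option S) B
  | None, None => \d_(None : borel_option S) B
  | _, _ => 0
  end.

Definition hvag_int (u : option S -> \bar R) (x : option S) (a : option T) :
    \bar R :=
  integral (hvag_trans x a) hvag_states u.

Definition hvag_op (phi : S -> T) (u : option S -> \bar R) (x : option S) :
    \bar R :=
  hvag_int u x (omap phi x).

Definition hvag_cost_of (phi : S -> T) (x : option S) : \bar R :=
  (hvag_cost x (omap phi x))%:E.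

Definition hvag_total_cost (phi : S -> T) (x : option S) : \bar R :=
  \sum_(0 <= n <oo)
    (beta ^+ n)%:E * iter n (hvag_op phi) (hvag_cost_of phi) x.

Definition hvag_value (x : option S) : \bar R :=
  ereal_inf [set hvag_total_cost phi x | phi in policies].

Definition hvag_argmin (x : S) : set T :=
  [set a | A x a /\
    hvag_value (Some x) = (hvag_cost (Some x) (Some a))%:E +
      beta%:E * hvag_int hvag_value (Some x) (Some a)].

End hvag.
End mdp.

(* Main.v *)
(* The transformed model has the contraction factor (K - 1) / K, because
   [mu x >= 1 + \int mu dq] off l and [1 <= mu <= K].  Its Bellman operator, cleared
   of the division by mu and with [h = mu (u - u l)], is the right-hand side of the
   average-cost optimality equation: the mass that the transformation sends to l
   compensates exactly the subtraction of [u l].  So the bounded fixed point u of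
   the Bellman operator, which is the discounted value function, solves the
   average-cost equation with [w = u l], and iterating the latter along a policy
   gives [w + (h - Q^N h) / N <= avg_N], with equality for minimizing policies;
   as h is bounded, w is the optimal average cost.

   The measure-theoretic substance is that value iteration stays within Borel
   functions and Borel policies: a Borel function on a Borel graph with compact
   sections, lower semicontinuous in the action, has a Borel selector of its
   minimizers.  This rests on the Borel measurability of the projection of a Borel
   set with compact sections, which in turn follows from Novikov's separation
   theorem for countable families of analytic sets. *)

Require Import Defs.
From HB Require Import structures.
From mathcomp Require Import all_boot all_order all_algebra.
From mathcomp Require Import all_classical all_reals all_analysis.
From mathcomp Require Import measurable_realfun.
From mathcomp Require Import ring lra.

Set Implicit Arguments.
Unset Strict Implicit.
Unset Printing Implicit Defensive.
Import Order.TTheory GRing.Theory Num.Theory.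
Import numFieldNormedType.Exports.

Local Open Scope classical_set_scope.
Local Open Scope ring_scope.

(** * Analytic sets and Novikov's separation theorem *)

(** The obstacle is that Assumption S gives regularity in the action only, for each fixed state; in
    the state the data are merely Borel. Measurability of a minimizer is thus a question about
    projections of Borel subsets of the graph, which in general are only analytic. Compact sections
    help because emptiness of a section then has a finite witness, and there are only countably many
    candidates for it. Separating a countable family at once, rather than two sets, is what yields
    one Borel choice for infinitely many coanalytic conditions simultaneously.

    In the discounted model [beta] disappears: [dop] is [beta] times the transformed expectation, so
    the powers of [beta] in the series cancel against the divisions by [beta] in the kernel. All
    estimates are made for bounded Borel real functions, and extended reals return only when the
    integrals of the statement are evaluated. *)

Definition agree (k : nat) (a b : nat -> nat) :=
  forall j, (j < k)%N -> a j = b j.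

Lemma agree_sub (k m : nat) (a b : nat -> nat) :
  (k <= m)%N -> agree m a b -> agree k a b.
Proof. by move=> km ab j jk; apply: ab; exact: leq_trans km. Qed.

(* Closedness in the product of the Baire space (nat with the discrete topology)
   with Y, spelled out on cylinders. *)
Definition closed_rel (Y : topologicalType) (C : (nat -> nat) -> set Y) :=
  forall a y, ~ C a y -> exists k, exists2 V, nbhs y V &
    forall b z, agree k a b -> V z -> ~ C b z.

(** Projection along the Baire space of a closed set. In this form countable unions and
    intersections are recodings of the Baire parameter, and no metric on [Y] enters. *)
Definition analytic (Y : topologicalType) (A : set Y) :=
  exists2 C : (nat -> nat) -> set Y, closed_rel C & A = \bigcup_a C a.

Definition bianalytic (Y : topologicalType) (A : set Y) :=
  analytic A /\ analytic (~` A).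

Definition precomp (g : nat -> nat) (a : nat -> nat) := a \o g.

(** Continuity of [precomp g] on the Baire space. *)
Lemma agree_precomp (g : nat -> nat) (k : nat) (a : nat -> nat) :
  exists m, forall b, agree m a b -> agree k (precomp g a) (precomp g b).
Proof.
elim: k => [|k [m IH]]; first by exists 0.
exists (maxn m (g k).+1) => b ab j; rewrite ltnS leq_eqVlt => /orP[/eqP->|jk].
  by apply: ab; rewrite leq_max ltnSn orbT.
by apply: IH => //; apply: agree_sub ab; rewrite leq_maxl.
Qed.

Lemma closed_rel_precomp (Y : topologicalType) (g : nat -> nat)
    (C : (nat -> nat) -> set Y) :
  closed_rel C -> closed_rel (fun a => C (precomp g a)).
Proof.
move=> clC a y /clC[k [V yV kV]]; have [m mP] := agree_precomp g k a.
by exists m, V => // b z /mP; exact: kV.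
Qed.

Lemma closed_rel_bigcap (Y : topologicalType) (I : Type)
    (C : I -> (nat -> nat) -> set Y) :
  (forall i, closed_rel (C i)) -> closed_rel (fun a => \bigcap_i C i a).
Proof.
move=> clC a y /existsNP[i /not_implyP[_ /(clC i)[k [V yV kV]]]].
by exists k, V => // b z ab Vz /(_ i Logic.I); exact: kV.
Qed.

(** One sequence [a] carries countably many, namely the [precomp (upair n) a]. The default of
    [odflt] concerns only numbers outside the range of [pickle]. *)
Definition upair (k m : nat) : nat := pickle (k, m).
Definition ufst (n : nat) : nat := (odflt (0, 0)%N (unpickle n)).1.
Definition usnd (n : nat) : nat := (odflt (0, 0)%N (unpickle n)).2.

Lemma upairK1 k m : ufst (upair k m) = k.
Proof. by rewrite /ufst /upair pickleK. Qed.

Lemma upairK2 k m : usnd (upair k m) = m.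
Proof. by rewrite /usnd /upair pickleK. Qed.

Section analytic.
Context {Y : topologicalType}.
Implicit Types A : set Y.

Lemma analytic_closed A : closed A -> analytic A.
Proof.
move=> clA; exists (fun=> A); last first.
  by apply/seteqP; split => [y Ay|y [a _]//]; exists (fun=> 0%N).
move=> a y nAy; exists 0%N, (~` A) => //.
by apply: open_nbhs_nbhs; split => //; exact: closed_openC.
Qed.

Lemma analytic_preimage (Z : topologicalType) (f : Y -> Z) (B : set Z) :
  continuous f -> analytic B -> analytic (f @^-1` B).
Proof.
move=> cf [C clC ->]; exists (fun a => f @^-1` C a); last first.
  by rewrite preimage_bigcup.
move=> a y /clC[k [V fyV kV]]; exists k, (f @^-1` V); first exact: cf.
by move=> b z ab /kV; exact.
Qed.

Lemma analytic_bigcup (A : nat -> set Y) :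
  (forall n, analytic (A n)) -> analytic (\bigcup_n A n).
Proof.
move=> /(_ _)/cid2-/all_sig2[C clC AC].
(* The first entry of the parameter names the member of the union; the shifted sequence is a
   parameter for that member. *)
exists (fun a => C (a 0%N) (precomp S a)).
  move=> a y /(closed_rel_precomp (g := S) (clC _))[k [V yV kV]].
  exists k.+1, V => // b z ab Vz; rewrite -(ab 0%N)//.
  by apply: kV => //; exact: agree_sub ab.
apply/seteqP; split => [y [n _]|y [a _ Cy]].
  by rewrite AC => -[a _ Cay]; exists (fun k => if k is k'.+1 then a k' else n).
by exists (a 0%N) => //; rewrite AC; exists (precomp S a).
Qed.

Lemma analytic_bigcap (A : nat -> set Y) :
  (forall n, analytic (A n)) -> analytic (\bigcap_n A n).
Proof.
move=> /(_ _)/cid2-/all_sig2[C clC AC].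
exists (fun a => \bigcap_n C n (precomp (upair n) a)).
  by apply: closed_rel_bigcap => n; exact: closed_rel_precomp.
apply/seteqP; split => [y Ay|y [a _ Cy] n _]; last first.
  by rewrite AC; exists (precomp (upair n) a) => //; exact: Cy.
have /choice[a aP] : forall n, exists a, C n a y.
  by move=> n; have := Ay n Logic.I; rewrite AC => -[a _]; exists a.
exists (fun m => a (ufst m) (usnd m)) => // n _.
by congr (C n _ y): (aP n); apply/funext => k; rewrite /precomp/= upairK1 upairK2.
Qed.

Lemma analytic0 : analytic (@set0 Y).
Proof. by apply: analytic_closed; exact: closed0. Qed.

Lemma analyticT : analytic [set: Y].
Proof. by apply: analytic_closed; exact: closedT. Qed.

Lemma analyticI A B : analytic A -> analytic B -> analytic (A `&` B).
Proof.
move=> aA aB; rewrite -bigcap2E; apply: analytic_bigcap => -[|[|n]]//=.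
exact: analyticT.
Qed.

Lemma analyticU A B : analytic A -> analytic B -> analytic (A `|` B).
Proof.
move=> aA aB; rewrite -bigcup2E; apply: analytic_bigcup => -[|[|n]]//=.
exact: analytic0.
Qed.

Lemma sigma_algebra_bianalytic : sigma_algebra setT (@bianalytic Y).
Proof.
split.
- by split; rewrite ?setC0; [exact: analytic0|exact: analyticT].
- by move=> A [? ?]; rewrite setTD; split => //; rewrite setCK.
- move=> A bA; split; first by apply: analytic_bigcup => n; exact: (bA n).1.
  by rewrite setC_bigcup; apply: analytic_bigcap => n; exact: (bA n).2.
Qed.

End analytic.

Lemma bianalytic_preimage (Y Z : topologicalType) (f : Y -> Z) (B : set Z) :
  continuous f -> bianalytic B -> bianalytic (f @^-1` B).
Proof.
move=> cf [B1 B2]; split; first exact: analytic_preimage.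
exact: (analytic_preimage cf B2).
Qed.

(* Frolik's complete sequences of countable covers: the only trace of Polishness
   needed here.  Unlike a coding by points, they pass to products at once. *)
Definition complete_covers (Y : topologicalType) (U : nat -> nat -> set Y) :=
  (forall k y, exists m, U k m y) /\
  forall b : nat -> nat,
    (forall k, exists y, forall j, (j < k)%N -> U j (b j) y) ->
    exists2 y, (forall j, U j (b j) y) & forall V, nbhs y V ->
      exists k, forall z, (forall j, (j < k)%N -> U j (b j) z) -> V z.

(** The coordinate [t] is absorbed into the Baire parameter: the subsequence [D a] chooses a member
    of each cover, which pins down [t], and [L a] is the old parameter. *)
Lemma analytic_fst (X T : topologicalType) (U : nat -> nat -> set T)
    (A : set (X * T)) :
  complete_covers U -> analytic A -> analytic (fst @` A).
Proof.
move=> [Ucov Ucpl] [C clC ->].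
pose L := precomp (upair 0); pose D := precomp (upair 1).
exists (fun a => [set x | exists2 t, (forall j, U j (D a j) t) & C (L a) (x, t)]);
    last first.
  apply/seteqP; split => [_ [[x t] [a _ Cxt] <-]/=|x [a _ [t Ut Cxt]]]; last first.
    by exists (x, t) => //; exists (L a).
  have /choice[b bP] : forall k, exists m, U k m t by move=> k; exact: Ucov.
  exists (fun m => if ufst m is 0%N then a (usnd m) else b (usnd m)) => //.
  exists t => [j|]; first by rewrite /D /precomp /= upairK1 upairK2.
  congr (C _ _) : Cxt.
  by apply/funext => j; rewrite /L /precomp /= upairK1 upairK2.
(* Failure at [(a, x)] is detected at a finite stage: either finitely many chosen members already
   have no common point, or they shrink to a point [t] and closedness of [C] at [(x, t)] applies. *)
move=> a x nC; have [Ua|/existsNP[k /forallNP nUa]] :=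
    pselect (forall k, exists t, forall j, (j < k)%N -> U j (D a j) t); last first.
  have [m mP] := agree_precomp (upair 1) k a.
  exists m, setT => [|b z ab _ [t Ut _]]; first exact: filterT.
  by apply: (nUa t) => j jk; rewrite /D (mP _ ab).
have [t Ut nbt] := Ucpl _ Ua.
have /clC[k [W [[V V'] /= [xV tV'] VW] kV]] : ~ C (L a) (x, t).
  by move=> Ct; apply: nC; exists t.
have [k' k'P] := nbt _ tV'.
have [m mP] := agree_precomp (upair 0) k a.
have [m' mP'] := agree_precomp (upair 1) k' a.
exists (maxn m m'), V => // b z ab Vz [t' Ut' Ct'].
apply: kV Ct'; first by apply: mP; apply: agree_sub ab; rewrite leq_maxl.
apply: VW; split => //=; apply: k'P => j jk'.
by rewrite /D (mP' b)//; apply: agree_sub ab; rewrite leq_maxr.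
Qed.

Lemma complete_coversX (X T : topologicalType) (U : nat -> nat -> set X)
    (V : nat -> nat -> set T) :
  complete_covers U -> complete_covers V ->
  complete_covers (fun k m => U k (ufst m) `*` V k (usnd m)).
Proof.
move=> [Uc Up] [Vc Vp]; split=> [k [x t]|b bP].
  have [m mP] := Uc k x; have [m' mP'] := Vc k t.
  by exists (upair m m'); rewrite upairK1 upairK2.
have [|x xU xP] := Up (ufst \o b).
  by move=> k; have [[x t] xtP] := bP k; exists x => j /xtP[].
have [|t tV tP] := Vp (usnd \o b).
  by move=> k; have [[x' t] xtP] := bP k; exists t => j /xtP[].
exists (x, t) => [j|W [[W1 W2] /= [/xP[k kP] /tP[k' k'P]] sW]].
  by split; [exact: xU|exact: tV].
exists (maxn k k') => -[x' t'] xt'; apply: sW; split => /=.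
  by apply: kP => j jk; have [|//] := xt' j; rewrite leq_max jk.
by apply: k'P => j jk; have [|//] := xt' j; rewrite leq_max jk orbT.
Qed.

Definition cyl (Y : Type) (D : (nat -> nat) -> set Y) (s : seq nat) : set Y :=
  [set y | exists2 a, (forall j, (j < size s)%N -> a j = nth 0%N s j) & D a y].

Lemma cylS (Y : Type) (D : (nat -> nat) -> set Y) (s : seq nat) :
  cyl D s `<=` \bigcup_m cyl D (rcons s m).
Proof.
move=> y [a sa Day]; exists (a (size s)) => //; exists a => // j.
rewrite size_rcons ltnS leq_eqVlt nth_rcons => /orP[/eqP->|js].
  by rewrite ltnn eqxx.
by rewrite js sa.
Qed.

Lemma cyl_mkseq_sub (Y : Type) (D : (nat -> nat) -> set Y) (a : nat -> nat)
    (k m : nat) : (k <= m)%N -> cyl D (mkseq a m) `<=` cyl D (mkseq a k).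
Proof.
move=> km y [b ab Dby]; exists b => // j; rewrite size_mkseq => jk.
by rewrite ab ?size_mkseq ?nth_mkseq// (leq_trans jk).
Qed.

(* Along a branch whose cylinders are all nonempty, the pieces of A cut out by
   these cylinders shrink to a point of A. *)
Definition shrinking (Y : topologicalType) (D : (nat -> nat) -> set Y)
    (A : set Y) :=
  forall a, (forall k, cyl D (mkseq a k) !=set0) ->
    exists2 y, A y &
      forall V, nbhs y V -> exists k, cyl D (mkseq a k) `<=` V.

(** Interleaving the parameter with choices from the covers makes every branch with nonempty
    cylinders converge; closedness of [C] puts the limit in [A]. *)
Lemma analytic_shrinking (Y : topologicalType) (U : nat -> nat -> set Y)
    (A : set Y) :
  complete_covers U -> analytic A ->
  exists2 D, A = \bigcup_a D a & shrinking D A.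
Proof.
move=> [Ucov Ucpl] [C clC ->].
exists (fun a => C (precomp (upair 0) a)
    `&` [set y | forall j, U j (a (upair 1 j)) y]).
  apply/seteqP; split => y [a _]; last by move=> [Cy _]; eexists; last exact: Cy.
  move=> Cay; have /choice[b bP] : forall k, exists m, U k m y by move=> k; exact: Ucov.
  exists (fun m => if ufst m is 0%N then a (usnd m) else b (usnd m)) => //.
  split=> [|j]/=; last by rewrite upairK1 upairK2.
  congr (C _ _) : Cay.
  by apply/funext => j; rewrite /precomp /= upairK1 upairK2.
move=> a a0; have [|y Uy nby] := Ucpl (precomp (upair 1) a).
  move=> k; have [m mP] := agree_precomp (upair 1) k a.
  have [y [b ab [_ Uby]]] := a0 m; exists y => j jk.
  rewrite (mP b)//.
  by move=> i im; rewrite ab ?size_mkseq ?nth_mkseq//.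
exists y => [|V /nby[k kP]].
  exists (precomp (upair 0) a) => //; apply: contrapT => /clC[k [V yV kV]].
  have [k' k'P] := nby _ yV.
  have [m mP] := agree_precomp (upair 0) k a.
  have [m' mP'] := agree_precomp (upair 1) k' a.
  have [z [b ab [Cbz Ubz]]] := a0 (maxn m m').
  have {}ab : agree (maxn m m') a b.
    by move=> i im; rewrite ab ?size_mkseq ?nth_mkseq//.
  apply: kV Cbz; first by apply: mP; apply: agree_sub ab; rewrite leq_maxl.
  apply: k'P => j jk; rewrite (mP' b)//.
  by apply: agree_sub ab; rewrite leq_maxr.
have [m mP] := agree_precomp (upair 1) k a.
exists m => z [b ab [_ Ubz]]; apply: kP => j jk.
rewrite (mP b)//.
by move=> i im; rewrite ab ?size_mkseq ?nth_mkseq//.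
Qed.

Section Novikov.
Context {Y : topologicalType} (B : set (set Y)).
Hypothesis sB : sigma_algebra setT B.
Hypothesis sepB : forall y z : Y, y <> z -> exists V W,
  [/\ nbhs y V, nbhs z W, B V, B W & V `&` W = set0].

Let B0 : B set0. Proof. by case: sB. Qed.
Let BC A : B A -> B (~` A). Proof. by case: sB => _ + _ => /(_ A); rewrite setTD. Qed.
Let BT : B setT. Proof. by rewrite -setC0; exact: BC. Qed.
Let Bcup (F : nat -> set Y) : (forall n, B (F n)) -> B (\bigcup_n F n).
Proof. by case: sB => _ _; exact. Qed.
Let Bcap (F : nat -> set Y) : (forall n, B (F n)) -> B (\bigcap_n F n).
Proof.
move=> BF; rewrite -[X in B X]setCK setC_bigcap; apply/BC/Bcup => n.
exact/BC/BF.
Qed.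

(** The envelopes are taken in an abstract sigma-algebra [B], because the result serves both for the
    Borel sets of a space and for the product sigma-algebra on a product. *)
Definition separated (A : nat -> set Y) := exists E : nat -> set Y,
  [/\ forall n, B (E n), forall n, A n `<=` E n & \bigcap_n E n = set0].

Definition upd {Z : Type} (A : nat -> Z) (i : nat) (z : Z) (n : nat) : Z :=
  if n == i then z else A n.

(** For the split member the envelopes of the pieces are united, for the others they are
    intersected: a common point lies in the [i]-th envelope of some piece [m], hence in all
    envelopes belonging to [m]. *)
Lemma separated_split (A : nat -> set Y) (i : nat) (F : nat -> set Y) :
  A i `<=` \bigcup_m F m -> (forall m, separated (upd A i (F m))) ->
  separated A.
Proof.
move=> AF /choice[E EP].
exists (fun n => if n == i then \bigcup_m E m i else \bigcap_m E m n); split.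
- move=> n; case: eqP => _.
    by apply: Bcup => m; have [+ _ _] := EP m; exact.
  by apply: Bcap => m; have [+ _ _] := EP m; exact.
- move=> n; case: eqP => [->|ni] y Ay.
    have [m _ Fm] := AF _ Ay; exists m => //.
    by have [_ /(_ i) + _] := EP m; rewrite /upd eqxx; exact.
  move=> m _; have [_ /(_ n) + _] := EP m; rewrite /upd.
  by move/eqP/negbTE : ni => ->; exact.
- rewrite -subset0 => y Ey.
  have := Ey i Logic.I; rewrite eqxx => -[m _ Emi].
  have [_ _ <-] := EP m; move=> n _.
  have [->//|ni] := eqVneq n i.
  by have := Ey n Logic.I; rewrite (negbTE ni); exact.
Qed.

Lemma separated2 (A : nat -> set Y) (i j : nat) (V W : set Y) :
  i <> j -> B V -> B W -> A i `<=` V -> A j `<=` W -> V `&` W = set0 ->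
  separated A.
Proof.
move=> ij BV BW AV AW VW0; exists (upd (upd (fun=> setT) i V) j W).
split=> [n|n|]; rewrite /upd.
- by case: ifP => // _; case: ifP.
- by case: ifP => [/eqP->//|_]; case: ifP => [/eqP->//|_].
- rewrite -subset0 -VW0 => y Ey; split; last first.
    by have := Ey j Logic.I; rewrite eqxx.
  by have := Ey i Logic.I; rewrite eqxx; case: eqP.
Qed.

(* If the family is not separated, splitting its members one at a time along
   cylinders keeps it so.  The schedule [logn 2] visits every index infinitely
   often, so in the limit each member shrinks to a point; two of these points
   differ, and disjoint neighbourhoods separate the family after all. *)
Theorem Novikov_separation (U : nat -> nat -> set Y) (A : nat -> set Y) :
  complete_covers U -> (forall n, analytic (A n)) -> \bigcap_n A n = set0 ->
  separated A.
Proof.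
move=> cU aA A0; apply: contrapT => nsep.
have /choice[D DP] : forall n, exists D, A n = \bigcup_a D a /\ shrinking D (A n).
  by move=> n; have [D ? ?] := analytic_shrinking cU (aA n); exists D.
pose bad (s : nat -> seq nat) := ~ separated (fun n => cyl (D n) (s n)).
have bad0 : bad (fun=> [::]).
  move=> [E [BE AE E0]]; apply: nsep; exists E; split => // n.
  apply: subset_trans (AE n); rewrite (DP n).1 => y [a _ Day].
  by exists a.
have /choice[f fP] : forall p : (nat -> seq nat) * nat, exists m,
    bad p.1 -> bad (upd p.1 p.2 (rcons (p.1 p.2) m)).
  move=> [s i] /=; apply: contrapT => /forallNP H.
  have bs : bad s by apply: contrapT => nb; apply: (H 0%N) => /nb.
  apply: bs; apply: (separated_split (i := i)); first exact: cylS.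
  move=> m; have /not_implyP[_ /contrapT] := H m.
  congr separated; apply/funext => n; rewrite /upd.
  by case: ifP => // /eqP ->.
pose s := fix s t := if t is t'.+1 then
  upd (s t') (logn 2 t) (rcons (s t' (logn 2 t)) (f (s t', logn 2 t)))
  else fun=> [::].
have bads t : bad (s t) by elim: t => // t /(fP (s t, logn 2 t.+1)).
have sS t n : prefix (s t n) (s t.+1 n).
  by rewrite /= /upd; case: eqP => [->|_]; rewrite ?prefix_rcons ?prefix_refl.
have sle t t' n : (t <= t')%N -> prefix (s t n) (s t' n).
  elim: t' => [|t' IH]; first by rewrite leqn0 => /eqP->.
  rewrite leq_eqVlt => /orP[/eqP->|]; first exact: prefix_refl.
  rewrite ltnS => /IH/prefix_trans; apply.
  exact: sS.
have ssize n k : exists t, (k <= size (s t n))%N.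
  elim: k => [|k [t kt]]; first by exists 0%N.
  (* The factor [2 ^ n] makes stage [t'] serve the index [n]; the odd factor makes it later than
     [t]. *)
  pose t' := (2 ^ n * t.*2.+1)%N.
  have tt' : (t < t')%N.
    by rewrite /t' (@leq_trans t.*2.+1)// ?ltnS -?addnn ?leq_addr// leq_pmull// expn_gt0.
  have lt' : logn 2 t' = n.
    rewrite lognM ?expn_gt0// pfactorK// lognE /= dvdn2 /= odd_double /=.
    by rewrite addn0.
  exists t'; case: t' tt' lt' => // t' tt' lt'.
  rewrite /= lt' /upd eqxx size_rcons ltnS (leq_trans kt)//.
  by apply: size_prefix; exact: sle.
have /choice[tau tauP] : forall p : nat * nat, exists t, (p.2 < size (s t p.1))%N.
  by move=> [n k]; exact: ssize.
pose a n j := nth 0%N (s (tau (n, j)) n) j.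
have sE t n : s t n = mkseq (a n) (size (s t n)).
  apply: (@eq_from_nth _ 0%N); rewrite ?size_mkseq// => j jt.
  rewrite nth_mkseq// /a; have tj := tauP (n, j).
  have [/sle|/ltnW/sle] := leqP t (tau (n, j)) => /(_ n)/prefixP[u ->];
    by rewrite nth_cat ?jt ?tj.
(* An empty cylinder would separate the family at once, with the envelopes [set0] and [setT]. *)
have cylN0 n k : cyl (D n) (mkseq (a n) k) !=set0.
  apply/set0P/eqP => c0; have [t kt] := ssize n k; apply: (bads t).
  apply: (@separated2 _ n n.+1 set0 setT) => //; last by rewrite set0I.
  - by rewrite sE -c0; exact: cyl_mkseq_sub.
have /choice[y yP] : forall n, exists y, A n y /\
    forall V, nbhs y V -> exists k, cyl (D n) (mkseq (a n) k) `<=` V.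
  by move=> n; have [y ? ?] := (DP n).2 _ (cylN0 n); exists y.
have [n /eqP yn] : exists n, y n != y 0%N.
  apply: contrapT => /forallNP y0; rewrite -[False]/(set0 (y 0%N)) -A0 => n _.
  by have /negP/negPn/eqP <- := y0 n; have [] := yP n.
have [V [W [nV nW BV BW VW0]]] := sepB yn.
have [k kP] := (yP n).2 _ nV; have [k' k'P] := (yP 0%N).2 _ nW.
have [t kt] := ssize n k; have [t' kt'] := ssize 0%N k'.
apply: (bads (maxn t t')); apply: (@separated2 _ n 0%N V W) => //.
- by move=> n0; apply: yn; rewrite n0.
- rewrite sE; apply: subset_trans kP; apply: cyl_mkseq_sub.
  by rewrite (leq_trans kt)// size_prefix// sle// leq_maxl.
- rewrite sE; apply: subset_trans k'P; apply: cyl_mkseq_sub.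
  by rewrite (leq_trans kt')// size_prefix// sle// leq_maxr.
Qed.

(** Separation is applied to [Z] together with the complements of the [C n], whose intersection is
    empty because the [C n] cover [Z]; complementing the envelopes gives [D]. *)
Corollary coanalytic_reduction (U : nat -> nat -> set Y) (Z : set Y)
    (C : nat -> set Y) :
  complete_covers U -> analytic Z -> (forall n, analytic (~` C n)) ->
  Z `<=` \bigcup_n C n ->
  exists D : nat -> set Y,
    [/\ forall n, B (D n), forall n, D n `<=` C n & Z `<=` \bigcup_n D n].
Proof.
move=> cU aZ aC ZC.
have [||E [BE AE E0]] :=
    @Novikov_separation U (fun n => if n is n'.+1 then ~` C n' else Z) cU.
- by case.
- rewrite -subset0 => y yP; have [n _ Cny] := ZC _ (yP 0%N Logic.I).
  exact: (yP n.+1 Logic.I).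
exists (fun n => ~` E n.+1); split => [n|n|y Zy].
- exact: BC.
- by rewrite -[X in _ `<=` X]setCK; apply: subsetC; exact: (AE n.+1).
- apply: contrapT => nE.
  rewrite -[False]/(set0 y) -E0 => -[_|n _]; first exact: (AE 0%N).
  by apply: contrapT => nEy; apply: nE; exists n.
Qed.

End Novikov.

(** * Borel sets with compact sections *)

Section metric.
Context {R : realType}.

Lemma closed_mdist_le (T : completeMetricType R) (x : T) (r : R) :
  closed [set t | mdist x t <= r].
Proof.
move=> p clp /=; apply/ler_addgt0Pr => e e0.
have [t [/= xt]] := clp _ (nbhsx_ballx p e e0).
rewrite ballEmdist /= metric_sym => pt.
by rewrite (le_trans (metric_triangle x t p))// lerD// ltW.
Qed.

Lemma open_mdist_lt (T : completeMetricType R) (x : T) (r : R) :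
  open [set t | mdist x t < r].
Proof.
rewrite openE => t /= xt; apply/nbhs_ballP.
exists (r - mdist x t) => /=; first by rewrite subr_gt0.
move=> s; rewrite ballEmdist /= ltrBrDl; apply: le_lt_trans.
exact: metric_triangle.
Qed.

Lemma analytic_open (T : completeMetricType R) (U : set T) : open U -> analytic U.
Proof.
move=> oU; pose F n := [set y | forall z, mdist y z < n.+1%:R^-1 -> U z].
suff -> : U = \bigcup_n F n.
  apply: analytic_bigcup => n; apply: analytic_closed => p clp z pz /=.
  have e0 : 0 < n.+1%:R^-1 - mdist p z by rewrite subr_gt0.
  have [y [/= Fy]] := clp _ (nbhsx_ballx p _ e0).
  rewrite ballEmdist /= ltrBrDr => py; apply: Fy.
  by apply: le_lt_trans py; rewrite (metric_sym p y) metric_triangle.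
apply/seteqP; split => [y Uy|y [n _]]; last first.
  by apply; rewrite mdistxx invr_gt0.
have /nbhs_ballP[e /= e0 yeU] := open_nbhs_nbhs (conj oU Uy).
have [n ne] := @ltr_add_invr R 0 e e0; exists n => // z yz.
apply: yeU; rewrite ballEmdist /=; apply: lt_trans yz _.
by rewrite add0r in ne.
Qed.

Lemma bianalytic_open (T : completeMetricType R) (U : set T) : open U -> bianalytic U.
Proof.
by move=> oU; split; [exact: analytic_open|exact/analytic_closed/open_closedC].
Qed.

Lemma borel_bianalytic (T : completeMetricType R) (A : set T) :
  measurable (A : set (borel T)) -> bianalytic A.
Proof.
apply: smallest_sub; first exact: sigma_algebra_bianalytic.
exact: bianalytic_open.
Qed.

Lemma borel_prod_bianalytic (S T : completeMetricType R) (A : set (S * T)) :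
  measurable (A : set (borel S * borel T)) -> bianalytic A.
Proof.
apply: smallest_sub; first exact: sigma_algebra_bianalytic.
move=> _ [] [B mB <-]; rewrite setTI; apply: bianalytic_preimage.
- by move=> z; exact: cvg_fst.
- exact: borel_bianalytic.
- by move=> z; exact: cvg_snd.
- exact: borel_bianalytic.
Qed.

Lemma borel_separation (T : completeMetricType R) (y z : T) : y <> z ->
  exists V W : set T, [/\ nbhs y V, nbhs z W, measurable (V : set (borel T)),
    measurable (W : set (borel T)) & V `&` W = set0].
Proof.
move=> /eqP; rewrite -mdist_gt0 => yz.
have yz2 : 0 < mdist y z / 2 by rewrite divr_gt0.
exists [set t | mdist y t < mdist y z / 2], [set t | mdist z t < mdist y z / 2].
split.
- by have := nbhsx_ballx y _ yz2; rewrite ballEmdist.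
- by have := nbhsx_ballx z _ yz2; rewrite ballEmdist.
- by apply: sub_sigma_algebra; exact: open_mdist_lt.
- by apply: sub_sigma_algebra; exact: open_mdist_lt.
- rewrite -subset0 => t /= [yt zt].
  have := metric_triangle y t z; rewrite leNgt => /negP; apply.
  by rewrite [ltRHS]splitr ltrD// metric_sym.
Qed.

Lemma borel_prod_separation (S T : completeMetricType R) (y z : S * T) : y <> z ->
  exists V W : set (S * T), [/\ nbhs y V, nbhs z W,
    measurable (V : set (borel S * borel T)),
    measurable (W : set (borel S * borel T)) & V `&` W = set0].
Proof.
move: y z => [y1 y2] [z1 z2] yz; have [yz1|/eqP yz1] := eqVneq y1 z1.
  have yz2 : y2 <> z2 by move=> yz2; apply: yz; rewrite yz1 yz2.
  have [V [W [yV zW mV mW VW]]] := borel_separation yz2.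
  exists (snd @^-1` V), (snd @^-1` W); split.
  - exact: (@cvg_snd _ _ (nbhs y1) (nbhs y2)).
  - exact: (@cvg_snd _ _ (nbhs z1) (nbhs z2)).
  - rewrite -[X in measurable X]setTI; exact: measurable_snd.
  - rewrite -[X in measurable X]setTI; exact: measurable_snd.
  - by rewrite -preimage_setI VW preimage_set0.
have [V [W [yV zW mV mW VW]]] := borel_separation yz1.
exists (fst @^-1` V), (fst @^-1` W); split.
- exact: (@cvg_fst _ _ (nbhs y1) (nbhs y2)).
- exact: (@cvg_fst _ _ (nbhs z1) (nbhs z2)).
- rewrite -[X in measurable X]setTI; exact: measurable_fst.
- rewrite -[X in measurable X]setTI; exact: measurable_fst.
- by rewrite -preimage_setI VW preimage_set0.
Qed.

(** The balls are closed so that the limit of a branch stays in its members, while by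
    [ball_cover_near] their interiors still cover the space, as compactness arguments require. *)
Definition ball_cover (T : completeMetricType R) (e : nat -> T) (k m : nat) : set T :=
  [set t | mdist (e m) t <= k.+1%:R^-1].

Lemma closed_ball_cover (T : completeMetricType R) (e : nat -> T) k m :
  closed (ball_cover e k m).
Proof. exact: closed_mdist_le. Qed.

Lemma ball_cover_diam (T : completeMetricType R) (e : nat -> T) k m s t :
  ball_cover e k m s -> ball_cover e k m t -> mdist s t <= 2 / k.+1%:R.
Proof.
rewrite /ball_cover /= => es et.
rewrite (le_trans (metric_triangle s (e m) t))// mulr_natl mulr2n.
by rewrite lerD// metric_sym.
Qed.

Lemma separable_seq (T : ptopologicalType) : separable T ->
  exists e : nat -> T, dense (range e).
Proof.
move=> [D cD dD]; have [D0|[e]] := pfcard_geP cD; last first.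
  by exists e; rewrite image_eq.
by have [|t []] := dD setT _ openT; [exists point|rewrite D0].
Qed.

Lemma two_div_lt (e : R) : 0 < e -> exists k, 2 / k.+1%:R < e.
Proof.
move=> e0; have [|k] := @ltr_add_invr R 0 (e / 2); first exact: divr_gt0.
by rewrite add0r => ke; exists k; rewrite mulrC -ltr_pdivlMr.
Qed.

Lemma ball_cover_near (T : completeMetricType R) (e : nat -> T) :
  dense (range e) -> forall k (t : T), exists m, nbhs t (ball_cover e k m).
Proof.
move=> de k t; have k0 : (0 : R) < k.+1%:R^-1 by rewrite invr_gt0.
have [|t' [/= + [m _ mt']]] := de [set s | mdist t s < k.+1%:R^-1] _ (open_mdist_lt _ _).
  by exists t; rewrite /= mdistxx.
rewrite -{}mt' => tm; exists m.
apply: (filterS (P := [set s | mdist (e m) s < k.+1%:R^-1])).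
  by move=> s /= /ltW.
by apply: open_nbhs_nbhs; split; [exact: open_mdist_lt|rewrite /= metric_sym].
Qed.

Lemma complete_ball_cover (T : completeMetricType R) (e : nat -> T) :
  dense (range e) -> complete_covers (ball_cover e).
Proof.
move=> de; split=> [k t|b bP].
  by have [m /nbhs_singleton] := ball_cover_near de k t; exists m.
have /choice[u uP] := bP.
have bu j n : (j < n)%N -> ball_cover e j (b j) (u n) by exact: uP.
have cu : cvg (u @ \oo).
  apply: cauchy_cvg; apply: cauchy_exP => eps eps0.
  have [k ke] := two_div_lt eps0; exists (u k.+1); exists k.+1 => // n /= kn.
  rewrite ballEmdist /=; apply: le_lt_trans ke.
  by apply: (ball_cover_diam (e := e) (m := b k)); apply: bu.
have lU j : ball_cover e j (b j) (lim (u @ \oo)).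
  apply: (closed_cvg _ _ _ _ cu); first exact: closed_ball_cover.
  by exists j.+1 => // n /=; exact: bu.
exists (lim (u @ \oo)) => // V /nbhs_ballP[eps /= eps0 epsV].
have [k ke] := two_div_lt eps0; exists k.+1 => z kz; apply: epsV.
rewrite ballEmdist /=; apply: le_lt_trans ke.
by apply: (ball_cover_diam (e := e) (m := b k)) => //; exact: kz.
Qed.

End metric.

Lemma ultra_cover (T : Type) (I : choiceType) (U : set_system T) (F : I -> set T)
    (s : seq I) : UltraFilter U ->
  U (\bigcup_(i in [set` s]) F i) -> exists i, U (F i).
Proof.
move=> UU; rewrite bigcup_seq; elim: s => [|i s IH].
  by rewrite big_nil => /filter_not_empty.
rewrite big_cons => Us; have [Ui|nUi] := in_ultra_setVsetC (F i) UU.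
  by exists i.
apply: IH; apply: filterS (filterI Us nUi) => t [[]//].
Qed.

Section compact_sections.
Context {R : realType}.

Definition balls (T : completeMetricType R) (e : nat -> T) (p : nat * seq nat) :
    set T := \bigcup_(m in [set` p.2]) ball_cover e p.1 m.

Lemma closed_balls (T : completeMetricType R) (e : nat -> T) p :
  closed (balls e p).
Proof.
by apply: closed_bigcup; [exact: finite_seq|move=> m _; exact: closed_ball_cover].
Qed.

(** Compactness without a compact set: as [D] contains finite unions of balls of every radius, an
    ultrafilter containing all these unions is Cauchy, and completeness gives the common point. *)
Lemma balls_fip (T : completeMetricType R) (e : nat -> T)
    (D : set (nat * seq nat)) :
  (forall k, exists s, D (k, s)) ->
  (forall s : seq (nat * seq nat), (forall i, i \in s -> D i) ->
    \bigcap_(i in [set` s]) balls e i !=set0) ->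
  \bigcap_(i in D) balls e i !=set0.
Proof.
move=> Dk Dfip.
pose F : set_system T := [set P | exists2 s : seq (nat * seq nat),
  (forall i, i \in s -> D i) & \bigcap_(i in [set` s]) balls e i `<=` P].
have FF : ProperFilter F.
  split; first by move=> [s /Dfip[t ts] s0]; exact: s0 ts.
  split; first by exists [::].
  - move=> P Q [s sD sP] [s' sD' sQ]; exists (s ++ s').
      by move=> i; rewrite mem_cat => /orP[/sD|/sD'].
    move=> t ts; split; [apply: sP|apply: sQ] => i /= si; apply: ts;
      by rewrite /= mem_cat si ?orbT.
  - by move=> P Q PQ [s sD sP]; exists s => //; exact: subset_trans PQ.
have [U [UU FU]] := ultraFilterLemma FF.
have UD i : D i -> U (balls e i).
  move=> Di; apply: FU; exists [:: i] => [j|t]; first by rewrite inE => /eqP->.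
  by apply; rewrite /= inE.
have cU : cvg U.
  apply: cauchy_cvg; apply: cauchy_exP => eps eps0.
  have [k ke] := two_div_lt eps0; have [s /UD] := Dk k.
  move=> /ultra_cover[m Um]; have [t mt] := filter_ex Um; exists t.
  apply: filterS Um => t' mt'; rewrite ballEmdist /=.
  by apply: le_lt_trans ke; apply: (ball_cover_diam (e := e) (m := m)).
exists (lim U) => i /UD Ui; apply: (@closed_balls _ e i (lim U)) => V /cU UV.
exact: (filter_ex (filterI Ui UV)).
Qed.

Lemma coanalytic_reduction_count (Y : topologicalType) (B : set (set Y))
    (U : nat -> nat -> set Y) (I : countType) (Z : set Y) (C : I -> set Y) :
  sigma_algebra setT B ->
  (forall y z : Y, y <> z -> exists V W,
    [/\ nbhs y V, nbhs z W, B V, B W & V `&` W = set0]) ->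
  complete_covers U -> analytic Z -> (forall i, analytic (~` C i)) ->
  Z `<=` \bigcup_i C i ->
  exists D : I -> set Y,
    [/\ forall i, B (D i), forall i, D i `<=` C i & Z `<=` \bigcup_i D i].
Proof.
move=> sB sepB cU aZ aC ZC.
have [||D [BD DC ZD]] := @coanalytic_reduction Y B sB sepB U Z
    (fun n => oapp C set0 (pickle_inv n)) cU aZ.
- move=> n; case: pickle_inv => [i|]//=; rewrite setC0; exact: analyticT.
- by move=> y /ZC[i _ Ciy]; exists (pickle i) => //; rewrite pickleK_inv.
exists (D \o pickle); split => [i|i|y Zy]; first exact: BD.
  by have := DC (pickle i); rewrite pickleK_inv.
have [n _ Dny] := ZD _ Zy; have := @pickle_invK I n; have := DC n _ Dny.
by case: pickle_inv => //= i _ ni; exists i => //=; rewrite ni.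
Qed.

(** The second clause keeps the cover tight: a point farther from [K] than the diameter bound
    [2 / k.+1%:R] lies in none of the listed balls. *)
Lemma compact_balls (T : completeMetricType R) (e : nat -> T) (K : set T)
    (k : nat) : dense (range e) -> compact K ->
  exists s : seq nat, K `<=` balls e (k, s) /\
    forall m, m \in s -> ball_cover e k m `&` K !=set0.
Proof.
move=> de; rewrite compact_cover.
move=> /(_ nat setT (fun m => interior (ball_cover e k m))).
case=> [m _|t Kt|D _ DK]; first exact: open_interior.
  by have [m mt] := ball_cover_near de k t; exists m.
exists [seq m <- finmap.enum_fset D | `[< ball_cover e k m `&` K !=set0 >]]; split.
  move=> t Kt; have [m /= mD /interior_subset mt] := DK _ Kt.
  by exists m => //=; rewrite mem_filter; apply/andP; split => //;
    apply/asboolP; exists t.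
by move=> m; rewrite mem_filter => /andP[/asboolP].
Qed.

(* With W ranging over the finite unions of closed balls, the sets
   [C W = {x | G_x `<=` W}] are coanalytic.  Reduction replaces them by Borel sets
   [D W] that still determine G_x as the intersection of the W with x in [D W], W
   ranging over arbitrarily small radii.  By completeness G_x is then empty iff
   finitely many of these W have an empty intersection. *)
Theorem measurable_proj_compact (S T : completeMetricType R)
    (G : set (borel S * borel T)) : separable S -> separable T ->
  measurable G -> (forall x, compact ([set t | G (x, t)] : set T)) ->
  measurable (fst @` G).
Proof.
move=> /separable_seq[e1 de1] /separable_seq[e de] mG cG.
have cS := complete_ball_cover de1; have cT := complete_ball_cover de.
have cST := complete_coversX cS cT.
have aG : @bianalytic (S * T)%type G := borel_prod_bianalytic mG.
have cfst : continuous (fst : S * T -> S) by move=> z; exact: cvg_fst.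
have csnd : continuous (snd : S * T -> T) by move=> z; exact: cvg_snd.
pose C i : set S := [set x | [set t | G (x, t)] `<=` balls e i].
have aC i : analytic (~` C i).
  have -> : ~` C i = fst @` ((G : set (S * T)) `&` snd @^-1` (~` balls e i)).
    apply/seteqP; split => [x /existsNP[t /not_implyP[Gxt it]]|_ [[x t] [Gxt it] <-]].
      by exists (x, t).
    by move=> /(_ t Gxt).
  apply: (analytic_fst cT); apply: analyticI; first exact: aG.1.
  apply: (analytic_preimage csnd); apply: analytic_open.
  exact/closed_openC/closed_balls.
(* [D1] provides, for each [x] and every radius, an index whose Borel set contains [x], which is the
   first hypothesis of [balls_fip]. *)
have /choice[D1 D1P] : forall k, exists D : seq nat -> set S,
    [/\ forall s, measurable (D s : set (borel S)),
      forall s, D s `<=` C (k, s) & setT `<=` \bigcup_s D s].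
  move=> k; apply: (coanalytic_reduction_count _ _ cS) => //.
  - exact: sigma_algebra_measurable.
  - exact: borel_separation.
  - exact: analyticT.
  - by move=> x _; have [s [sG _]] := compact_balls k de (cG x); exists s.
(* Each point [t] off the section at [x] is excluded by some finite union of balls containing that
   section; reduction in the product makes the choice of the union Borel in [(x, t)]. *)
have [B [mB BC GB]] : exists B : nat * seq nat -> set (S * T),
    [/\ forall i, measurable (B i : set (borel S * borel T)),
      forall i, B i `<=` fst @^-1` C i `&` snd @^-1` (~` balls e i) &
      ~` (G : set (S * T)) `<=` \bigcup_i B i].
  apply: (coanalytic_reduction_count _ _ cST).
  - exact: sigma_algebra_measurable.
  - exact: borel_prod_separation.
  - exact: aG.2.
  - move=> i; rewrite setCI; apply: analyticU.
      exact: (analytic_preimage cfst (aC i)).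
    rewrite -preimage_setC setCK; apply: (analytic_preimage csnd).
    exact/analytic_closed/closed_balls.
  - move=> [x t] nGxt.
    have clG : closed ([set t' | G (x, t')] : set T).
      by apply: compact_closed => //; exact: metric_hausdorff.
    have /nbhs_ballP[eps /= eps0 epsG] :
        nbhs (t : T) (~` [set t' | G (x, t')]).
      by apply: open_nbhs_nbhs; split => //; exact: closed_openC.
    have [k ke] := two_div_lt eps0.
    have [s [sG sG0]] := compact_balls k de (cG x).
    exists (k, s) => //; split => //= -[m /= /sG0[t' [mt' Gt']] mt].
    apply: (epsG t') => //; rewrite ballEmdist /=; apply: le_lt_trans ke.
    exact: ball_cover_diam mt mt'.
(* The projection of [B i] is analytic and lies in the coanalytic [C i]; reduction with a constant
   family interposes a Borel set. Thus the indices [i] with [x] in [D2 i] still exclude every [t]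
   off the section. *)
have /choice[D2 D2P] : forall i, exists D : set S,
    [/\ measurable (D : set (borel S)), D `<=` C i & fst @` B i `<=` D].
  move=> i.
  have [|||||D [mD DC BD]] := @coanalytic_reduction S
    (@measurable _ (borel S)) _ _ _ (fst @` B i) (fun=> C i) cS.
  - exact: sigma_algebra_measurable.
  - exact: borel_separation.
  - apply: (analytic_fst cT); exact: (borel_prod_bianalytic (mB i)).1.
  - by [].
  - by move=> _ [xt /BC[? _] <-]; exists 0%N.
  exists (\bigcup_n D n); split => //; first exact: bigcupT_measurable.
  exact: bigcup_sub.
pose D i := D1 i.1 i.2 `|` D2 i.
have mD i : measurable (D i : set (borel S)).
  apply: measurableU; last by have [] := D2P i.
  by have [+ _ _] := D1P i.1; exact.
have DC i : D i `<=` C i.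
  rewrite subUset; split; last by have [] := D2P i.
  by have [_ /(_ i.2)] := D1P i.1; case: (i).
pose J := [set s : seq (nat * seq nat) | \bigcap_(i in [set` s]) balls e i = set0].
have -> : fst @` G = ~` \bigcup_(s in J) \bigcap_(i in [set` s]) D i.
  apply/seteqP; split => [_ [[x t] Gxt <-] [s Js xs]|x].
    rewrite -[False]/((set0 : set T) t) -Js => i si.
    exact: (DC _ _ (xs i si) t).
  apply: contraPP => nGx [].
  have [] := pselect (\bigcap_(i in [set i | D i x]) balls e i !=set0).
    move=> [t xt]; exfalso; apply: nGx; exists (x, t) => //; apply: contrapT.
    move=> /GB[i _ Bi]; have [_ /= + ] := BC _ _ Bi; apply; apply: xt.
    by right; have [_ _] := D2P i; apply; exists (x, t).
  move=> H; have [s sH] : exists s : seq (nat * seq nat), ~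
    ((forall i, i \in s -> D i x) -> \bigcap_(i in [set` s]) balls e i !=set0).
    apply: contrapT => /forallNP Hs; apply: H; apply: balls_fip => [k|s].
      by have [_ _ /(_ x Logic.I)[s _ sx]] := D1P k; exists s; left.
    by have /contrapT := Hs s.
  move/not_implyP : sH => [sD /set0P/negP/negPn/eqP s0].
  by exists s.
apply: measurableC.
rewrite bigcup_mkcond; apply: countable_bigcupT_measurable => // s.
by case: ifP => // _; rewrite bigcap_seq; exact: bigsetI_measurable.
Qed.

End compact_sections.

(** * Borel selectors of Borel sets with compact sections *)

Section selection.
Context {R : realType}.

Lemma nested_compact (T : topologicalType) (K : nat -> set T) :
  hausdorff_space T -> (forall n, compact (K n)) -> (forall n, K n !=set0) ->
  (forall n, K n.+1 `<=` K n) -> \bigcap_n K n !=set0.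
Proof.
move=> hT cK K0 KS.
have Kle m n : (m <= n)%N -> K n `<=` K m.
  elim: n => [|n IH]; first by rewrite leqn0 => /eqP->.
  rewrite leq_eqVlt => /orP[/eqP->//|]; rewrite ltnS => /IH.
  exact: subset_trans (KS n).
pose F : set_system T := [set P | exists n, K n `<=` P].
have FF : ProperFilter F.
  split; first by move=> [n n0]; have [t /n0] := K0 n.
  split; first by exists 0%N.
  - move=> P Q [m mP] [n nQ]; exists (maxn m n) => t mnt.
    by split; [apply: mP|apply: nQ]; apply: Kle mnt; rewrite ?leq_maxl ?leq_maxr.
  - by move=> P Q PQ [n nP]; exists n; exact: subset_trans PQ.
have [|t [K0t tF]] := cK 0%N F FF; first by exists 0%N.
exists t => n _; apply: (compact_closed hT (cK n)) => V tV.
by apply: tF => //; exists n.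
Qed.

Section slices.
Context (S T : completeMetricType R) (e : nat -> T).
Implicit Types G H : set (borel S * borel T).

Let ball_slice H k m : set (borel S * borel T) :=
  H `&` snd @^-1` (ball_cover e k m : set (borel T)).

(* Keeps in each section only the part in the first ball of radius 1/(k+1) that
   meets the section. *)
Definition first_ball k H : set (borel S * borel T) :=
  \bigcup_m (ball_slice H k m `\`
    fst @^-1` \bigcup_(m' in `I_m) fst @` (ball_slice H k m')).

Fixpoint ball_iter H n :=
  if n is n'.+1 then first_ball n' (ball_iter H n') else H.

Let nice H :=
  measurable H /\ forall x, compact ([set t | H (x, t)] : set T).

Lemma first_ball_sub k H : first_ball k H `<=` H.
Proof. by apply: bigcup_sub => m _ xt [[]]. Qed.

Hypotheses (sepS : separable S) (sepT : separable T) (de : dense (range e)).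

Lemma nice_closed H (C : set T) : closed C -> nice H ->
  nice (H `&` snd @^-1` (C : set (borel T))).
Proof.
move=> clC [mH cH]; split.
  apply: measurableI => //; rewrite -[X in measurable X]setTI.
  apply: measurable_snd => //; rewrite -[C]setCK; apply: measurableC.
  by apply: sub_sigma_algebra; exact: closed_openC.
move=> x; have -> : [set t | (H `&` snd @^-1` (C : set (borel T))) (x, t)]
  = [set t | H (x, t)] `&` C by [].
by apply: compact_closedI => //; exact: cH.
Qed.

Lemma nice_proj H : nice H -> measurable (fst @` H).
Proof. by move=> [mH cH]; exact: measurable_proj_compact. Qed.

(** A nonempty section of [first_ball k H] is the section of a single slice, hence compact. It is
    Borel because the slices removed have compact sections and so Borel projections. *)
Lemma nice_first_ball k H : nice H -> nice (first_ball k H).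
Proof.
move=> nH; have nB m : nice (ball_slice H k m).
  by apply: nice_closed => //; exact: closed_ball_cover.
split=> [|x].
  apply: bigcupT_measurable => m; apply: measurableD; first exact: (nB m).1.
  rewrite -[X in measurable X]setTI; apply: measurable_fst => //.
  by apply: bigcup_measurable => m' _; exact: nice_proj.
have [[t [m _ xtm]]|E0] := pselect ([set t | first_ball k H (x, t)] !=set0); last first.
  suff -> : [set t | first_ball k H (x, t)] = set0 by exact: compact0.
  by rewrite -subset0 => t xt; apply: E0; exists t.
suff -> : [set t | first_ball k H (x, t)] = [set t | ball_slice H k m (x, t)].
  exact: (nB m).2.
apply/seteqP; split => [s [m' _ xsm']|s xs].
  have [mm'|m'm|<-//] := ltngtP m' m; last by case: xsm'.
    by case: xtm => _ /= []; exists m' => //; exists (x, s) => //; case: xsm'.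
  by case: xsm' => _ /= []; exists m => //; exists (x, t) => //; case: xtm.
by exists m => //; split => //; case: xtm.
Qed.

Lemma nice_ball_iter n H : nice H -> nice (ball_iter H n).
Proof. by move=> nH; elim: n => //= n; exact: nice_first_ball. Qed.

Lemma first_ball_neq0 k H x t : H (x, t) -> exists s, first_ball k H (x, s).
Proof.
move=> Hxt; have ex : exists m, `[< (fst @` ball_slice H k m) x >].
  have [cov _] := complete_ball_cover de.
  by have [m mt] := cov k t; exists m; apply/asboolP; exists (x, t).
case: (ex_minnP ex) => m /asboolP[[x' s] xs /= x'x] mmin.
rewrite {x'}x'x in xs.
exists s; exists m => //; split => //= -[m' /= m'm m'x].
by have := mmin m' (asboolT m'x); rewrite leqNgt m'm.
Qed.

Lemma ball_iter_neq0 n H x t : H (x, t) -> exists s, ball_iter H n (x, s).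
Proof.
by move=> Hxt; elim: n => [|n [s Hxs]]; [exists t|exact: first_ball_neq0 Hxs].
Qed.

Lemma first_ball_diam k H x s t : first_ball k H (x, s) ->
  first_ball k H (x, t) -> mdist (s : T) t <= 2 / k.+1%:R.
Proof.
move=> [m _ [xsm xsm']] [m' _ [xtm xtm']].
have [mm'|m'm|mm'] := ltngtP m m'.
- by case: xtm' => /=; exists m => //; exists (x, s).
- by case: xsm' => /=; exists m' => //; exists (x, t).
- apply: (ball_cover_diam (e := e) (m := m)); first by case: xsm.
  by rewrite mm'; case: xtm.
Qed.

(** The sections of [ball_iter H n] are nested nonempty compact sets with diameters tending to 0;
    [phi x] is their only common point. *)
Theorem measurable_selection H : nice H ->
  exists2 phi : borel S -> borel T, measurable_fun (fst @` H) phi &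
    forall x, (fst @` H) x -> H (x, phi x).
Proof.
move=> nH; have hT : hausdorff_space T by exact: metric_hausdorff.
have nI n := nice_ball_iter n nH.
have inter x (C : set T) : closed C ->
    (forall n, (fst @` (ball_iter H n `&` snd @^-1` (C : set (borel T)))) x) ->
    exists2 t, C t & forall n, ball_iter H n (x, t).
  move=> clC xC.
  have [||n|t tP] := @nested_compact T (fun n => [set t |
      (ball_iter H n `&` snd @^-1` (C : set (borel T))) (x, t)]) hT.
  - by move=> n; exact: (nice_closed clC (nI n)).2.
  - by move=> n; have [[x' t] xt /= x'x] := xC n; exists t; rewrite -x'x.
  - by move=> t [xt Ct]; split => //; exact: first_ball_sub xt.
  - by exists t => [|n]; [have [] := tP 0%N Logic.I|have [] := tP n Logic.I].
have /choice[phi phiP] : forall x : borel S, exists t : borel T,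
    (fst @` H) x -> forall n, ball_iter H n (x, t).
  move=> x; have [Hx|nx] := pselect ((fst @` H) x); last by exists point.
  have [[x' t] + /= x'x] := Hx; rewrite {x'}x'x => xt.
  have [|n|s _ sP] := inter x setT.
  - exact: closedT.
  - by have [u xu] := ball_iter_neq0 n xt; exists (x, u).
  - by exists s.
have phi_uniq x t : (fst @` H) x -> (forall n, ball_iter H n (x, t)) ->
    t = phi x.
  move=> Hx tP; apply: (@mdist_positivity R T); apply/eqP.
  rewrite eq_le mdist_ge0 andbT leNgt; apply/negP => /two_div_lt[k].
  rewrite ltNge => /negP; apply; apply: (@first_ball_diam k (ball_iter H k) x).
    exact: (tP k.+1).
  exact: (phiP x Hx k.+1).
exists phi => [|x Hx]; last exact: (phiP x Hx 0%N).
(* By compactness [phi x] lies in [C] iff every iterate meets [C] over [x], and each of these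
   conditions is the projection of a set with compact sections. *)
have phiC (C : set (borel T)) : closed (C : set T) ->
    fst @` H `&` phi @^-1` C =
    \bigcap_n fst @` (ball_iter H n `&` snd @^-1` C).
  move=> clC; apply/seteqP; split => [x [Hx Cx] n _|x xC].
    by exists (x, phi x) => //; split => //; exact: phiP.
  have [|t Ct tP] := inter x C clC; first by move=> n; exact: xC.
  have Hx : (fst @` H) x by exists (x, t) => //; exact: (tP 0%N).
  by split => //=; rewrite -(phi_uniq _ _ Hx tP).
have mH : measurable (fst @` H) by exact: nice_proj.
apply: (measurability (rT := borel T) (@open T)) => [//|_ [U oU <-]].
have -> : fst @` H `&` phi @^-1` U = fst @` H `\` (fst @` H `&` phi @^-1` (~` U)).
  by apply/seteqP; split => x [Hx Ux]; split => //;
    [case|apply: contrapT => nU; exact: Ux].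
apply: measurableD => //; rewrite phiC; last exact: open_closedC.
apply: bigcapT_measurable => n; apply: nice_proj; apply: nice_closed => //.
exact: open_closedC.
Qed.

End slices.
End selection.

(** * Borel selectors of minimizers *)

Section argmin.
Context {R : realType}.

(* Comparing with rational levels only makes the set of minimizers Borel without
   knowing beforehand that the minimum is a measurable function of x. *)
Theorem measurable_argmin (S T : completeMetricType R)
    (G : set (borel S * borel T)) (f : S -> T -> R) :
  separable S -> separable T ->
  measurable G -> measurable_fun G (fun xt => f xt.1 xt.2) ->
  (forall x, compact ([set t | G (x, t)] : set T)) ->
  (forall x r, compact ([set t | G (x, t) /\ f x t <= r] : set T)) ->
  exists2 phi : borel S -> borel T, measurable_fun (fst @` G) phi &
    forall x, (fst @` G) x ->
      G (x, phi x) /\ forall t, G (x, t) -> f x (phi x) <= f x t.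
Proof.
move=> sepS sepT mG mf cG cGf.
have hT : hausdorff_space T by exact: metric_hausdorff.
have [e de] := separable_seq sepT.
pose L (q : rat) := [set xt : borel S * borel T | G xt /\ f xt.1 xt.2 <= ratr q].
pose H := [set xt | G xt /\ forall q, (fst @` L q) xt.1 -> f xt.1 xt.2 <= ratr q].
have HP x t : H (x, t) <-> G (x, t) /\ forall s, G (x, s) -> f x t <= f x s.
  split=> -[Gxt xtP]; split => //.
    move=> s Gxs; rewrite leNgt; apply/negP => xst.
    have [q] := rat_in_itvoo xst; rewrite in_itv /= => /andP[sq qt].
    have : f x t <= ratr q.
      by apply: xtP; exists (x, s) => //; split => //=; exact: ltW.
    by rewrite leNgt qt.
  by move=> q [[x' s] [Gxs xs] /= x'x]; apply: le_trans xs;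
    rewrite x'x in Gxs *; exact: xtP.
have mL q : measurable (L q).
  have -> : L q = G `&` (fun xt => f xt.1 xt.2) @^-1` [set` `]-oo, ratr q]].
    by apply/seteqP; split => xt /= []; rewrite in_itv.
  exact: mf.
have mH : measurable H.
  have -> : H = G `&` ~` \bigcup_q
      (fst @^-1` (fst @` L q) `\` (fun xt => L q xt)).
    apply/seteqP; split => [xt [Gxt xtP]|xt [Gxt xtP]]; split => //.
      by move=> [q _ [xtq]]; apply; split => //; exact: xtP.
    move=> q xtq; apply: contrapT => nq; apply: xtP; exists q => //.
    by split => // -[].
  apply: measurableI => //; apply: measurableC.
  apply: bigcupT_measurable_rat => q; apply: measurableD; last exact: mL.
  rewrite -[X in measurable X]setTI; apply: measurable_fst => //.
  by apply: measurable_proj_compact => // x; exact: cGf.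
have cH x : compact ([set t | H (x, t)] : set T).
  apply: subclosed_compact (cG x) _; last by move=> t [].
  have -> : [set t | H (x, t)] = [set t | G (x, t)] `&`
      \bigcap_(q in [set q | (fst @` L q) x]) [set t | G (x, t) /\ f x t <= ratr q].
    apply/seteqP; split => t [Gxt xtP]; split => // q xq.
      by split => //; exact: xtP.
    by have [] := xtP _ xq.
  apply: closedI; first exact: compact_closed.
  by apply: closed_bigI => q _; exact: compact_closed.
have projH : fst @` H = fst @` G.
  apply/seteqP; split => [_ [xt [Gxt _] <-]|]; first by exists xt.
  move=> _ [[x t] Gxt <-] /=; pose V := [set f x s | s in [set s | G (x, s)]].
  (* The sublevel sets at the levels [- n%:R] are nested and compact; if none were empty, a common
     point would have a value below every integer. *)
  have infV : has_inf V.
    split; first by exists (f x t), t.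
    apply: contrapT => /forallNP nlb.
    have [||n|s sP] := @nested_compact T (fun n => [set s | G (x, s) /\
        f x s <= - n%:R]) hT.
    - by move=> n; exact: cGf.
    - move=> n; apply: contrapT => n0; apply: (nlb (- n%:R)) => _ [s Gxs <-].
      by rewrite leNgt; apply/negP => /ltW xs; apply: n0; exists s.
    - move=> s [Gxs xs]; split => //; apply: le_trans xs _.
      by rewrite lerN2 ler_nat.
    have [_] := sP (Num.bound `|f x s|) Logic.I; rewrite leNgt => /negP; apply.
    rewrite ltrNl; apply: le_lt_trans (archi_boundP (normr_ge0 _)).
    by rewrite -normrN ler_norm.
  have [||n|s sP] := @nested_compact T (fun n => [set s | G (x, s) /\
      f x s <= inf V + n.+1%:R^-1]) hT.
  - by move=> n; exact: cGf.
  - move=> n; have [|_ [s Gxs <-] xs] := @inf_adherent _ V n.+1%:R^-1 _ infV => //.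
    by exists s; split => //; exact: ltW.
  - move=> s [Gxs xs]; split => //; apply: le_trans xs _.
    by rewrite lerD2l lef_pV2 ?posrE// ler_nat.
  exists (x, s) => //; apply/HP; split; first by have [] := sP 0%N Logic.I.
  move=> u Gxu; apply: (@le_trans _ _ (inf V)); last first.
    by apply: ge_inf; [exact: infV.2|exists u].
  rewrite leNgt; apply/negP => Vs.
  have [n] := ltr_add_invr Vs.
  by rewrite ltNge; have [_ ->] := sP n Logic.I.
have [phi mphi phiP] := measurable_selection sepS sepT de (conj mH cH).
exists phi => [|x]; first by rewrite -projH.
by rewrite -projH => /phiP/HP.
Qed.

End argmin.

(** * Integrals under setwise convergence of measures *)

Section setwise.
Import HBNNSimple.

(** A form of Fatou's lemma: integrals of simple functions are finite combinations of measures of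
    sets and therefore converge, and the bound [r] passes to the limit of an increasing
    approximation of [f]. *)
Lemma setwise_le_integral d (Y : measurableType d) (R : realType)
    (m_ : nat -> {measure set Y -> \bar R}) (m : {measure set Y -> \bar R})
    (D : set Y) (f : Y -> \bar R) (r : \bar R) :
  (forall B, measurable B -> m_ n B @[n --> \oo] --> m B) ->
  measurable D -> measurable_fun D f -> (forall y, D y -> 0 <= f y)%E ->
  (forall n, \int[m_ n]_(y in D) f y <= r)%E ->
  (\int[m]_(y in D) f y <= r)%E.
Proof.
move=> m_m mD mf f0 fr; rewrite integral_mkcond.
have {}fr n : (\int[m_ n]_y (f \_ D) y <= r)%E by rewrite -integral_mkcond.
move: mf f0; set g := f \_ D => mf f0.
have mg : measurable_fun setT g by exact/(measurable_restrictT _ mD).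
have g0 y : setT y -> (0 <= g y)%E by move=> _; apply: erestrict_ge0.
pose g_ := nnsfun_approx measurableT mg.
have -> : (\int[m]_y g y = \int[m]_y lim ((g_ k y)%:E @[k --> \oo]))%E.
  by apply: eq_integral => y _; apply/esym/cvg_lim => //; exact: cvg_nnsfun_approx.
have ndg y k k' : (k <= k')%N -> ((g_ k y)%:E <= (g_ k' y)%:E)%E.
  by move=> kk'; rewrite lee_fin; exact/lefP/nd_nnsfun_approx.
apply: cvge_le; last first.
  apply: cvg_monotone_convergence => //.
  - by move=> k; exact/measurable_EFinP.
  - by move=> k y _; rewrite lee_fin.
  - by move=> y _ k k'; exact: ndg.
apply: nearW => k; rewrite integralT_nnsfun.
have cv : sintegral (m_ n) (g_ k) @[n --> \oo] --> sintegral m (g_ k).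
  have fin : finite_set (range (g_ k)) by exact: fimfunP.
  rewrite sintegralE fsbig_finite//.
  under eq_fun do rewrite sintegralE fsbig_finite//.
  apply: cvg_nnesum => [z _|z _].
    by apply: nearW => n; exact: nnsfun_mulemu_ge0.
  by apply: cvgeZl => //; apply: m_m; exact: measurable_funPTI.
apply: cvge_le cv.
  apply: nearW => n; rewrite -integralT_nnsfun; apply: le_trans (fr n).
  apply: ge0_le_integral => //.
  - by move=> y _; rewrite lee_fin.
  - exact/measurable_EFinP.
  - move=> y _; apply: cvge_ge (cvg_nnsfun_approx measurableT mg g0 Logic.I).
    by exists k => // k' /= kk'; exact: ndg.
exact: eventually_filter.
Qed.

End setwise.

(** * Integrals with respect to the transition probabilities *)

Lemma measurable_fun_pair_in d d1 d2 (Y : measurableType d)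
    (Y1 : measurableType d1) (Y2 : measurableType d2) (D : set Y)
    (f : Y -> Y1) (g : Y -> Y2) :
  measurable D -> measurable_fun D f -> measurable_fun D g ->
  measurable_fun D (fun y => (f y, g y)).
Proof.
move=> mD mf mg.
apply: (measurability (rT := (Y1 * Y2)%type) 
    (preimage_set_system setT fst measurable `|`
     preimage_set_system setT snd measurable)) => //.
by move=> _ [_ [] [B mB <-] <-]; rewrite setTI; [exact: mf|exact: mg].
Qed.

Section mdp.
Context (R : realType) (S T : completeMetricType R) (M : borel_mdp S T).
Local Notation X := (states M).
Local Notation A := (act M).
Local Notation c := (cost M).
Local Notation q := (trans M).
Local Notation Gr := (action_graph X A).
Implicit Types u v : S -> R.

Definition bounded_measurable u :=
  measurable_fun (X : set (borel S)) (u : borel S -> R) /\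
  exists C, forall x, X x -> `|u x| <= C.

Local Notation bm := bounded_measurable.

Definition ev (x : S) (a : T) u : R :=
  Rintegral (q x a) (X : set (borel S)) (u : borel S -> R).

Let mX : measurable (X : set (borel S)) := measurable_states M.

Lemma bm_cst r : bm (cst r).
Proof. by split; [exact: measurable_cst|exists `|r|]. Qed.

Lemma bmD u v : bm u -> bm v -> bm (u \+ v).
Proof.
move=> [mu [C uC]] [mv [D vD]]; split; first exact: measurable_funD.
by exists (C + D) => x Xx; rewrite (le_trans (ler_normD _ _))// lerD ?uC ?vD.
Qed.

Lemma bmM u v : bm u -> bm v -> bm (u \* v).
Proof.
move=> [mu [C uC]] [mv [D vD]]; split; first exact: measurable_funM.
by exists (C * D) => x Xx; rewrite normrM ler_pM ?uC ?vD.
Qed.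

Lemma bmZ r u : bm u -> bm (fun y => r * u y).
Proof. by move=> bu; apply: (bmM (bm_cst r)). Qed.

Lemma bmB u v : bm u -> bm v -> bm (u \- v).
Proof.
move=> bu bv; have -> : u \- v = u \+ (fun y => -1 * v y).
  by apply/funext => y /=; rewrite mulN1r.
exact: bmD (bmZ _ bv).
Qed.

Lemma bm_indic (B : set S) : measurable (B : set (borel S)) -> bm (\1_B).
Proof.
move=> mB; split; first exact: measurable_indic.
by exists 1 => x _; rewrite indicE; case: (_ \in _); rewrite ?normr1 ?normr0.
Qed.

Hypothesis qp : transition_probabilities M.

Section fixed.
Variables (x : S) (a : T).
Hypotheses (Xx : X x) (Aa : A x a).

Lemma bm_integrable u : bm u ->
  (q x a).-integrable (X : set (borel S)) (EFin \o u : borel S -> \bar R).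
Proof.
move=> [mu [C uC]]; apply: measurable_bounded_integrable => //.
  by rewrite qp// ltry.
exists C; split; [exact: num_real|move=> r Cr y Xy]; exact: le_trans (uC y Xy) (ltW Cr).
Qed.

Lemma EFin_ev u : bm u -> (\int[q x a]_(y in X) (u y)%:E = (ev x a u)%:E)%E.
Proof.
move=> /bm_integrable iu; rewrite /ev /Rintegral fineK//.
exact: integrable_fin_num iu.
Qed.

Lemma evD u v : bm u -> bm v -> ev x a (u \+ v) = ev x a u + ev x a v.
Proof. by move=> /bm_integrable iu /bm_integrable iv; exact: RintegralD. Qed.

Lemma evZ r u : bm u -> ev x a (fun y => r * u y) = r * ev x a u.
Proof. by move=> /bm_integrable iu; exact: RintegralZl. Qed.

Lemma evB u v : bm u -> bm v -> ev x a (u \- v) = ev x a u - ev x a v.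
Proof. by move=> /bm_integrable iu /bm_integrable iv; exact: RintegralB. Qed.

Lemma ev_le u v : bm u -> bm v -> (forall y, X y -> u y <= v y) ->
  ev x a u <= ev x a v.
Proof. by move=> /bm_integrable iu /bm_integrable iv uv; exact: le_Rintegral. Qed.

Lemma ev_cst r : ev x a (cst r) = r.
Proof. by rewrite /ev Rintegral_cst// (qp Xx Aa) /= mulr1. Qed.

Lemma ev_norm_le u C : bm u -> (forall y, X y -> `|u y| <= C) ->
  `|ev x a u| <= C.
Proof.
move=> bu uC; rewrite ler_norml -[X in X <= _ <= _]ev_cst -[X in _ <= _ <= X]ev_cst.
by rewrite !ev_le//; [exact: bm_cst|move=> y /uC; rewrite ler_norml => /andP[]|
  exact: bm_cst|move=> y /uC; rewrite ler_norml => /andP[]].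
Qed.

End fixed.

Lemma eq_ev x a u v : (forall y, X y -> u y = v y) -> ev x a u = ev x a v.
Proof. by move=> uv; apply: eq_Rintegral => y /set_mem; exact: uv. Qed.

Lemma measurable_ev u : bm u ->
  measurable_fun Gr (fun xa => ev xa.1 xa.2 u).
Proof.
move=> bu; have [_ [C uC]] := bu.
(* The kernel is controlled on the graph only, so it is continued by the zero measure. *)
pose k (xa : borel S * borel T) : {measure set (borel S) -> \bar R} :=
  if `[< Gr xa >] then q xa.1 xa.2 else mzero.
have mk B : measurable B -> measurable_fun setT (k ^~ B).
  move=> mB; have := @measurable_trans R S T M B mB.
  move/(measurable_restrictT _ (measurable_graph M)).
  congr (measurable_fun _ _); apply/funext => xa.
  rewrite patchE /k; case: (asboolP (Gr xa)) => h; first by rewrite mem_set.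
  by rewrite memNset.
(* Shifted by its bound, [u] becomes nonnegative; as the mass is 1, the shift is subtracted again
   afterwards. *)
pose g : borel S -> \bar R := ((EFin \o (u \+ cst C)) \_ (X : set (borel S)))%R.
have bg : bm (u \+ cst C) by apply: bmD => //; exact: bm_cst.
have mg : measurable_fun setT g.
  apply/(measurable_restrictT _ mX); apply/measurable_EFinP; exact: bg.1.
have g0 y : (0 <= g y)%E.
  apply: erestrict_ge0 => z Xz; rewrite lee_fin.
  by have := uC z Xz; rewrite ler_norml => /andP[+ _] /=; rewrite -lerBlDr sub0r.
have mI := measurable_fun_integral_kernel mk g0 mg.
have {}mI : measurable_fun Gr (fun xa : borel S * borel T => fine (\int[k xa]_y g y)).
  apply: measurable_funTS; apply: measurableT_comp mI; exact: fine_measurable.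
apply: (eq_measurable_fun (fun xa : borel S * borel T =>
    fine (\int[k xa]_y g y) - C)); last exact: measurable_funB.
move=> xa /set_mem Gxa; rewrite /k asboolT//.
have -> : (\int[q xa.1 xa.2]_y g y = (ev xa.1 xa.2 (u \+ cst C))%:E)%E.
  by rewrite -EFin_ev//; [rewrite /g -integral_mkcond|case: Gxa|case: Gxa].
rewrite /= evD//; [|by case: Gxa|by case: Gxa|exact: bm_cst].
by rewrite ev_cst ?addrK//; case: Gxa.
Qed.

Hypothesis hS : assumptionS M.

Lemma ev_lsc x u (a_ : nat -> T) (a : T) r : X x -> bm u ->
  (forall n, A x (a_ n)) -> A x a -> a_ @ \oo --> a ->
  (forall n, ev x (a_ n) u <= r) -> ev x a u <= r.
Proof.
move=> Xx bu Aa_ Aa a_a evr; have [_ [C uC]] := bu.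
have bg : bm (u \+ cst C) by apply: bmD => //; exact: bm_cst.
have evC b : A x b -> ev x b (u \+ cst C) = ev x b u + C.
  by move=> Ab; rewrite evD ?ev_cst//; exact: bm_cst.
rewrite -(lerD2r C) -evC// -lee_fin -EFin_ev//.
apply: (@setwise_le_integral _ _ _ (fun n => q x (a_ n))) => //.
- move=> B mB; exact: (hS.2 x Xx a_ a Aa_ Aa a_a B mB).
- by apply/measurable_EFinP; exact: bg.1.
- move=> y Xy; rewrite lee_fin /=.
  by have := uC y Xy; rewrite ler_norml => /andP[+ _] /=; rewrite -lerBlDr sub0r.
- by move=> n; rewrite EFin_ev// lee_fin evC// lerD2r.
Qed.

Lemma cost_lsc x a r : X x -> A x a -> r < c x a ->
  \forall b \near a, A x b -> r < c x b.
Proof.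
move=> Xx Aa ra; have [_ lsc] := hS.1 x Xx.
have [|V aV Vr] := lsc (a : subspace (A x)) r; first by rewrite lte_fin.
have wV : \forall b \near a, A x b -> V b.
  by move: aV; rewrite /nbhs /= -nbhs_subspace_in.
near=> b => Ab; rewrite -lte_fin; apply: Vr; move: Ab; near: b.
exact: wV.
Unshelve. all: by end_near.
Qed.

Lemma compact_sublevel x u r : X x -> bm u ->
  compact [set a | A x a /\ c x a + ev x a u <= r].
Proof.
move=> Xx bu; have [cA _] := hS.1 x Xx.
apply: (subclosed_compact _ cA); last by move=> a [].
move=> a cla.
have Aa : A x a.
  apply: (compact_closed (@metric_hausdorff R T) cA) => V aV.
  by have [b [[Ab _] Vb]] := cla V aV; exists b.
(* Near the cluster point the cost exceeds [c x a - e], so along a sequence in the sublevel set the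
   expectations stay below [r - c x a + e]. A sequence, taken in shrinking balls, is what the
   setwise continuity speaks of. *)
split => //; rewrite -lerBrDl; apply/ler_addgt0Pr => e e0.
have ce : c x a - e < c x a by rewrite ltrBlDr ltrDl.
have /choice[a_ a_P] : forall n, exists b, [/\ A x b, c x b + ev x b u <= r,
    c x a - e < c x b & ball a n.+1%:R^-1 b].
  move=> n; have n0 : (0 : R) < n.+1%:R^-1 by rewrite invr_gt0.
  have [b [[Ab br] [Ve ab]]] :=
    cla _ (filterI (cost_lsc Xx Aa ce) (nbhsx_ballx a _ n0)).
  by exists b; split => //; exact: Ve.
apply: (@ev_lsc _ _ a_) => //.
- by move=> n; have [] := a_P n.
- apply/cvg_ballP => d d0; have [n] := ltr_add_invr d0; rewrite add0r => nd.
  exists n => // m /= nm; have [_ _ _] := a_P m; apply: le_ball.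
  by apply: le_trans (ltW nd); rewrite lef_pV2 ?posrE// ler_nat.
- move=> n; have [_ nr ne _] := a_P n.
  have : ev x (a_ n) u <= r - c x (a_ n) by rewrite lerBrDl.
  move=> /le_trans; apply; rewrite -addrA lerD2l lerNl opprD opprK.
  exact: ltW.
Qed.

Hypothesis c_bounded : bounded_cost M.

Lemma exists_minimizer u : bm u -> exists2 phi, policies M phi &
  forall x a, X x -> A x a ->
    c x (phi x) + ev x (phi x) u <= c x a + ev x a u.
Proof.
move=> bu.
have sec x (P : T -> Prop) : X x ->
    [set t | Gr (x, t) /\ P t] = [set t | A x t /\ P t].
  by move=> Xx; apply/seteqP; split => t [At Pt]; split => //; case: At.
have proj : fst @` Gr = (X : set (borel S)).
  apply/seteqP; split => [_ [xa [? _] <-]//|x Xx].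
  by have [a Aa] := @act_neq0 R S T M x Xx; exists (x, a).
have [|||phi mphi phiP] := @measurable_argmin R S T Gr
   (fun x a => c x a + ev x a u) (separable_states M) (separable_actions M)
   (measurable_graph M).
- by apply: measurable_funD; [exact: measurable_cost|exact: measurable_ev].
- move=> x; have [Xx|nXx] := pselect (X x).
    have [cA _] := hS.1 x Xx; congr compact : cA.
    by apply/seteqP; split => [t At|t []].
  suff -> : [set t | Gr (x, t)] = set0 by exact: compact0.
  by rewrite -subset0 => t [].
- move=> x r; have [Xx|nXx] := pselect (X x).
    by rewrite sec//; exact: compact_sublevel.
  suff -> : [set t | Gr (x, t) /\ c x t + ev x t u <= r] = set0 by exact: compact0.
  by rewrite -subset0 => t [[]].
rewrite proj in mphi phiP; exists phi; first split => //.
  by move=> x Xx; have [[_ Ax] _] := phiP x Xx.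
by move=> x a Xx Aa; have [_ minx] := phiP x Xx; exact: minx.
Qed.

Lemma bm_policy u phi : policies M phi -> bm u -> bm (fun x => ev x (phi x) u).
Proof.
move=> [mphi Aphi] bu; split; last first.
  have [_ [C uC]] := bu; exists C => x Xx; apply: ev_norm_le => //; exact: Aphi.
pose g (x : borel S) : borel S * borel T := (x, phi x).
have mg : measurable_fun (X : set (borel S)) g 
    by apply: measurable_fun_pair_in => //; exact: measurable_id.
apply: (measurable_comp (measurable_graph M) _ (measurable_ev bu) mg).
by move=> _ [x Xx <-]; split => //; exact: Aphi.
Qed.

Lemma bm_cost phi : policies M phi -> bm (fun x => c x (phi x)).
Proof.
move=> [mphi Aphi]; split; last first.
  by have [C cC] := c_bounded; exists C => x Xx; apply: cC => //; exact: Aphi.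
pose g (x : borel S) : borel S * borel T := (x, phi x).
have mg : measurable_fun (X : set (borel S)) g 
    by apply: measurable_fun_pair_in => //; exact: measurable_id.
apply: (measurable_comp (measurable_graph M) _ (@measurable_cost R S T M) mg).
by move=> _ [x Xx <-]; split => //; exact: Aphi.
Qed.

End mdp.

(** * The discounted model *)

Section density.
Local Open Scope ereal_scope.
Import HBNNSimple.

(** Provides the part of the transformed transition probability carried by the states other than
    [l]: the image under [Some] of the law weighted by [mu] off [l]. *)
Lemma exists_pushforward_density d d' (Z : measurableType d)
    (Y : measurableType d') (R : realType) (m : {measure set Z -> \bar R})
    (psi : Z -> Y) (f : Z -> R) :
  measurable_fun setT psi -> measurable_fun setT f ->
  (forall z, (0 <= f z)%R) ->
  exists nu : {measure set Y -> \bar R},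
    (forall B, nu B = \int[m]_(z in psi @^-1` B) (f z)%:E) /\
    forall u : Y -> \bar R, measurable_fun setT u -> (forall y, 0 <= u y) ->
      \int[nu]_y u y = \int[m]_z (u (psi z) * (f z)%:E).
Proof.
move=> mpsi mf f0.
pose dens (B : set Y) := \int[m]_(z in psi @^-1` B) (f z)%:E.
have mpre B : measurable B -> measurable (psi @^-1` B).
  by move=> mB; rewrite -[X in measurable X]setTI; exact: mpsi.
have mEf : measurable_fun setT (EFin \o f) by exact/measurable_EFinP.
have d0 : dens set0 = 0 by rewrite /dens preimage_set0 integral_set0.
have dge0 B : 0 <= dens B by apply: integral_ge0 => y _; rewrite lee_fin.
have dsig : semi_sigma_additive dens.
  move=> F mF tF mUF; rewrite /dens preimage_bigcup.
  have Ef0 z : 0 <= (EFin \o f) z by rewrite lee_fin.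
  apply: (semi_sigma_additive_nng_induced mEf Ef0 (F := fun n => psi @^-1` F n)).
  - by move=> n; exact/mpre/mF.
  - apply/trivIsetP => i j _ _ ij; rewrite -preimage_setI.
    by move/trivIsetP : tF => ->//; rewrite preimage_set0.
  - by rewrite -preimage_bigcup; exact: mpre.
pose dmix := isMeasure.Build _ _ _ dens d0 dge0 dsig.
pose nu : {measure set Y -> \bar R} := HB.pack dens dmix.
exists nu; split => // u mu u0; pose h := nnsfun_approx measurableT mu.
have hu y : (h n y)%:E @[n --> \oo] --> u y by exact: cvg_nnsfun_approx.
have ndh y j k : (j <= k)%N -> ((h j y)%:E <= (h k y)%:E).
  by move=> jk; rewrite lee_fin; exact/lefP/nd_nnsfun_approx.
transitivity (\int[nu]_y lim ((h n y)%:E @[n --> \oo])).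
  by apply: eq_integral => y _; apply/esym/cvg_lim.
transitivity (\int[m]_z lim ((h n (psi z))%:E * (f z)%:E @[n --> \oo])); last first.
  by apply: eq_integral => z _; apply/cvg_lim => //; exact: cvgeZr.
rewrite !monotone_convergence//; last 6 first.
- move=> n; apply: emeasurable_funM => //.
  by apply/measurable_EFinP; exact: measurableT_comp.
- by move=> n y _; rewrite mule_ge0// lee_fin.
- by move=> y _ j k jk; rewrite lee_wpmul2r ?lee_fin//; exact/lefP/nd_nnsfun_approx.
- by move=> n; exact/measurable_EFinP.
- by move=> n y _; rewrite lee_fin.
- by move=> y _ j k; exact: ndh.
congr (lim (_ @ \oo)); apply/funext => n; rewrite integralT_nnsfun sintegralE.
have mA r : measurable (psi @^-1` (h n @^-1` [set r])).
  exact/mpre/measurable_funPTI.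
transitivity (\int[m]_z (\sum_(r \in range (h n))
    (r * \1_(h n @^-1` [set r]) (psi z))%:E * (f z)%:E)); last first.
  apply: eq_integral => z _.
  rewrite -ge0_mule_fsuml => [|r]; last exact: nnfun_muleindic_ge0.
  by rewrite fsumEFin // -(fimfunE _ (psi z)).
rewrite ge0_integral_fsum//; last 2 first.
- move=> r; apply: emeasurable_funM => //.
  apply/measurable_EFinP; apply: measurable_funM => //.
  have mI : measurable_fun setT (\1_(h n @^-1` [set r]) : Y -> R).
    by apply: measurable_indic; exact: measurable_funPTI.
  exact: (measurableT_comp mI mpsi).
- by move=> r y _; rewrite mule_ge0 ?lee_fin// -lee_fin nnfun_muleindic_ge0.
apply: eq_fsbigr => r /set_mem[y0 _ <-]; set A := h n @^-1` _.
transitivity (\int[m]_z ((h n y0)%:E * (((EFin \o f) \_ (psi @^-1` A)) z))).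
  rewrite ge0_integralZl//.
  - by rewrite -integral_mkcond.
  - by apply/(measurable_restrictT _ (mA _)); exact: measurable_funTS.
  - by move=> y _; apply: erestrict_ge0 => z _; rewrite lee_fin.
  - by rewrite lee_fin.
apply: eq_integral => z _; rewrite patchE indicE.
have -> : (z \in psi @^-1` A) = (psi z \in A).
  by apply/idP/idP; rewrite !inE.
by case: (_ \in _); rewrite ?mulr1// mulr0 mule0 mul0e.
Qed.
End density.

(** With [D'] the sum of the geometric series, [a_ n - k ^+ n * D'] is nondecreasing and
    [a_ n + k ^+ n * D'] nonincreasing; the supremum of the former is the limit and comes with its
    error bound. *)
Lemma geometric_limit (R : realType) (a_ : nat -> R) (k D : R) :
  0 <= k < 1 -> (forall n, `|a_ n.+1 - a_ n| <= k ^+ n * D) ->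
  exists a, forall n, `|a - a_ n| <= k ^+ n * (D / (1 - k)).
Proof.
move=> /andP[k0 k1] aD; set D' := D / (1 - k).
have D'E : D = D' - k * D'.
  by rewrite -[X in X - _]mul1r -mulrBl mulrC divfK// subr_eq0 gt_eqF.
have step n : a_ n - k ^+ n * D' <= a_ n.+1 - k ^+ n.+1 * D' /\
    a_ n.+1 + k ^+ n.+1 * D' <= a_ n + k ^+ n * D'.
  have := aD n; rewrite D'E exprSr ler_norml => /andP[]; lra.
have lo m n : a_ n - k ^+ n * D' <= a_ (n + m)%N - k ^+ (n + m) * D'.
  elim: m => [|m IH]; first by rewrite addn0.
  by rewrite addnS; apply: le_trans IH (step _).1.
have hi m n : a_ (n + m)%N + k ^+ (n + m) * D' <= a_ n + k ^+ n * D'.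
  elim: m => [|m IH]; first by rewrite addn0.
  by rewrite addnS; apply: le_trans (step _).2 IH.
have D'0 : 0 <= D'.
  rewrite divr_ge0// ?subr_ge0 ?(ltW k1)//.
  by have := le_trans (normr_ge0 _) (aD 0%N); rewrite expr0 mul1r.
have kD n : 0 <= k ^+ n * D' by rewrite mulr_ge0// exprn_ge0.
have lohi m n : a_ m - k ^+ m * D' <= a_ n + k ^+ n * D'.
  have [/subnKC <-|/ltnW/subnKC <-] := leqP m n.
    by apply: le_trans (lo _ _) _; have := kD (m + (n - m))%N; lra.
  by apply: le_trans (hi (m - n)%N n); have := kD (n + (m - n))%N; lra.
exists (sup (range (fun n => a_ n - k ^+ n * D'))) => n.
have ub m : ubound (range (fun n => a_ n - k ^+ n * D')) (a_ m + k ^+ m * D').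
  by move=> _ [j _ <-].
rewrite ler_distl; apply/andP; split.
  by apply: ub_le_sup; [exists (a_ 0%N + k ^+ 0 * D')|exists n].
by apply: ge_sup => //; exists (a_ 0%N - k ^+ 0 * D'), 0%N.
Qed.

Lemma geometric_cvg0 (R : realType) (k D : R) : 0 <= k < 1 ->
  k ^+ n * D @[n --> \oo] --> 0.
Proof.
move=> /andP[k0 k1]; rewrite -[X in _ --> X](mul0r D).
by apply: cvgMl; apply: cvg_expr; rewrite ger0_norm.
Qed.

Lemma le_geometric0 (R : realType) (k D r : R) : 0 <= k < 1 ->
  (forall n, r <= k ^+ n * D) -> r <= 0.
Proof.
move=> k01 rD; apply: (cvgr_to_ge (@geometric_cvg0 R k D k01)).
exact: nearW.
Qed.

(** * The Bellman operator of the transformed model *)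

Section discount.
Context (R : realType) (S T : completeMetricType R) (M : borel_mdp S T).
Local Notation X := (states M).
Local Notation A := (act M).
Local Notation c := (cost M).
Local Notation bm := (bounded_measurable M).
Local Notation ev := (ev M).
Hypothesis qp : transition_probabilities M.
Hypothesis hS : assumptionS M.
Hypothesis c_bounded : bounded_cost M.
Variables (l : S) (K : R) (mu : S -> R).
Hypothesis l_state : X l.
Hypothesis mu_meas : measurable_fun (X : set (borel S)) (mu : borel S -> R).
Hypothesis mu_ge1 : forall x, X x -> 1 <= mu x.
Hypothesis mu_leK : forall x, X x -> mu x <= K.
Hypothesis hmu : forall x a, X x -> A x a ->
  (1 + \int[trans M x a]_(y in X `\ l) (mu y)%:E <= (mu x)%:E)%E.
Implicit Types (x y : S) (a : T) (u v : S -> R) (phi : S -> T).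

Let K_ge1 : 1 <= K. Proof. exact: le_trans (mu_ge1 l_state) (mu_leK l_state). Qed.
Let K_gt0 : 0 < K. Proof. exact: lt_le_trans K_ge1. Qed.
Let mu_gt0 x : X x -> 0 < mu x. Proof. by move=> /mu_ge1; exact: lt_le_trans. Qed.
Let mX : measurable (X : set (borel S)) := measurable_states M.

Definition kappa : R := (K - 1) / K.

Lemma kappa01 : 0 <= kappa < 1.
Proof.
rewrite /kappa divr_ge0 ?subr_ge0//=; last exact: ltW.
by rewrite ltr_pdivrMr// mul1r gtrBl.
Qed.

Lemma bm_mu : bm mu.
Proof.
split => //; exists K => x Xx; rewrite ger0_norm ?mu_leK//.
exact/ltW/mu_gt0.
Qed.

Lemma bm_muV : bm (fun x => (mu x)^-1).
Proof.
split; last first.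
  exists 1 => x Xx; rewrite ger0_norm ?invr_ge0 ?(ltW (mu_gt0 Xx))//.
  by rewrite invf_le1 ?mu_gt0// mu_ge1.
apply: (eq_measurable_fun (fun x : borel S => mu x `^ (-1))).
  by move=> x /set_mem Xx; rewrite powR_inv1// ltW// mu_gt0.
exact: (measurableT_comp (measurable_powR (-1))).
Qed.

(** Turns integrals over the states other than [l] into integrals over all states, to which the
    rules for [ev] apply. *)
Definition off_l u : S -> R := u \* \1_(~` [set l]).

Lemma off_l_neq u y : y <> l -> off_l u y = u y.
Proof. by move=> yl; rewrite /off_l /= indicE mem_set ?mulr1. Qed.

Lemma off_l_eq u : off_l u l = 0.
Proof. by rewrite /off_l /= indicE memNset ?mulr0//; apply. Qed.

Lemma bm_off_l u : bm u -> bm (off_l u).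
Proof.
move=> bu; apply: bmM => //; apply: bm_indic; apply: sub_sigma_algebra.
apply: closed_openC; apply: compact_closed; first exact: metric_hausdorff.
exact: compact_set1.
Qed.

Lemma integral_off_l x a u : X x -> A x a -> bm u ->
  (\int[trans M x a]_(y in X `\ l) (u y)%:E = (ev x a (off_l u))%:E)%E.
Proof.
move=> Xx Aa bu; rewrite -EFin_ev//; last exact: bm_off_l.
rewrite setDE integral_mkcondr; apply: eq_integral => y _.
rewrite patchE /off_l /= indicE; case: ifP => _; by rewrite ?mulr1 ?mulr0.
Qed.

Lemma ev_off_mu x a : X x -> A x a -> 0 <= ev x a (off_l mu) <= mu x - 1.
Proof.
move=> Xx Aa; apply/andP; split.
  rewrite -(ev_cst qp Xx Aa 0); apply: ev_le => //; first exact: bm_cst.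
    exact: bm_off_l bm_mu.
  move=> y Xy /=; have [->|/eqP yl] := eqVneq y l; first by rewrite off_l_eq.
  by rewrite off_l_neq// ltW// mu_gt0.
have := hmu Xx Aa; rewrite integral_off_l//; last exact: bm_mu.
by rewrite -EFinD lee_fin lerBrDl.
Qed.

(* [beta] times the integral of u against the transformed transition probability,
   for a function u that vanishes at the additional state; see [hvag_intE]. *)
Definition dop x a u : R :=
  (mu x)^-1 * (ev x a (fun y => (u y - u l) * mu y) + (mu x - 1) * u l).

Lemma bm_centered u : bm u -> bm (fun y => (u y - u l) * mu y).
Proof.
move=> bu; apply: (bmM (u := fun y => u y - u l) _ bm_mu).
by apply: (bmB bu); exact: bm_cst.
Qed.

(** The definition of [dop] exhibits the centred function of the average-cost equation; this form
    exhibits nonnegative weights, from which monotonicity follows. *)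
Lemma dopE x a u : X x -> A x a -> bm u ->
  dop x a u = (mu x)^-1 * (ev x a (off_l (u \* mu)) +
    (mu x - 1 - ev x a (off_l mu)) * u l).
Proof.
move=> Xx Aa bu; rewrite /dop; congr (_ * _).
have bm1 : bm (off_l (u \* mu)) by apply: bm_off_l; exact: (bmM bu bm_mu).
have bm2 : bm (fun y => u l * off_l mu y) by apply: bmZ; exact: bm_off_l bm_mu.
rewrite (@eq_ev _ _ _ _ x a _ (off_l (u \* mu) \- (fun y => u l * off_l mu y))).
  rewrite evB// evZ//; last exact: bm_off_l bm_mu.
  by ring.
move=> y Xy /=; have [->|/eqP yl] := eqVneq y l.
  by rewrite !off_l_eq subrr mul0r mulr0 subr0.
by rewrite !off_l_neq// mulrBl.
Qed.

Lemma dopB x a u v : X x -> A x a -> bm u -> bm v ->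
  dop x a (u \- v) = dop x a u - dop x a v.
Proof.
move=> Xx Aa bu bv; rewrite !dopE//; last exact: bmB.
rewrite (@eq_ev _ _ _ _ x a _ (off_l (u \* mu) \- off_l (v \* mu))); last first.
  by move=> y _; rewrite /off_l /=; ring.
rewrite evB//; [|exact: (bm_off_l (bmM bu bm_mu))|exact: (bm_off_l (bmM bv bm_mu))].
by rewrite /=; ring.
Qed.

Lemma dopZ x a r u : X x -> A x a -> bm u ->
  dop x a (fun y => r * u y) = r * dop x a u.
Proof.
move=> Xx Aa bu; rewrite !dopE//; last exact: bmZ.
rewrite (@eq_ev _ _ _ _ x a _ (fun y => r * off_l (u \* mu) y)); last first.
  by move=> y _; rewrite /off_l /=; ring.
rewrite evZ//; last exact: (bm_off_l (bmM bu bm_mu)).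
by ring.
Qed.

Lemma eq_dop x a u v : (forall y, X y -> u y = v y) -> dop x a u = dop x a v.
Proof.
move=> uv; rewrite /dop uv//; congr (_ * (_ + _)).
by apply: eq_ev => y Xy; rewrite !uv.
Qed.

Lemma dop_ge0 x a u : X x -> A x a -> bm u -> (forall y, X y -> 0 <= u y) ->
  0 <= dop x a u.
Proof.
move=> Xx Aa bu u0; rewrite dopE// mulr_ge0 ?invr_ge0 ?(ltW (mu_gt0 Xx))//.
have /andP[_ evmu] := ev_off_mu Xx Aa.
rewrite addr_ge0// ?mulr_ge0 ?subr_ge0 ?u0//.
rewrite -(ev_cst qp Xx Aa 0); apply: ev_le => //; first exact: bm_cst.
  exact: (bm_off_l (bmM bu bm_mu)).
move=> y Xy /=; have [->|/eqP yl] := eqVneq y l; first by rewrite off_l_eq.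
by rewrite off_l_neq// mulr_ge0 ?u0// ltW// mu_gt0.
Qed.

Lemma dop_le x a u v : X x -> A x a -> bm u -> bm v ->
  (forall y, X y -> u y <= v y) -> dop x a u <= dop x a v.
Proof.
move=> Xx Aa bu bv uv; rewrite -subr_ge0 -dopB//; apply: dop_ge0 => //.
  exact: bmB.
by move=> y Xy; rewrite subr_ge0 uv.
Qed.

(** The total mass [1 - (mu x)^-1] is at most [1 - K^-1 = kappa], which is the source of the
    contraction. *)
Lemma dop_cst x a r : X x -> A x a -> dop x a (cst r) = r * (1 - (mu x)^-1).
Proof.
move=> Xx Aa; rewrite /dop (@eq_ev _ _ _ _ x a _ (cst 0)).
  rewrite ev_cst//= add0r mulrA mulrC mulrBr mulr1 mulVf//.
  by rewrite gt_eqF// mu_gt0.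
by move=> y _; rewrite subrr mul0r.
Qed.

Lemma dop_norm_le x a u D : X x -> A x a -> bm u ->
  (forall y, X y -> `|u y| <= D) -> `|dop x a u| <= kappa * D.
Proof.
move=> Xx Aa bu uD.
have D0 : 0 <= D by exact: le_trans (normr_ge0 _) (uD _ Xx).
apply: (@le_trans _ _ (D * (1 - (mu x)^-1))); last first.
  rewrite mulrC ler_wpM2r// /kappa mulrBl divff ?gt_eqF// mul1r lerD2l lerN2.
  by rewrite lef_pV2 ?posrE ?mu_gt0// mu_leK.
rewrite -(dop_cst D Xx Aa) ler_norml; apply/andP; split.
  rewrite -[X in - X]mul1r -mulNr -dopZ//; last exact: bm_cst.
  apply: dop_le => //; first by apply: bmZ; exact: bm_cst.
  by move=> y Xy /=; rewrite mulN1r; have := uD y Xy; rewrite ler_norml => /andP[].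
apply: dop_le => //; first exact: bm_cst.
by move=> y Xy; have := uD y Xy; rewrite ler_norml => /andP[].
Qed.

Definition dcost x a : R := (mu x)^-1 * c x a.

Lemma bm_dcost phi : policies M phi -> bm (fun x => dcost x (phi x)).
Proof. by move=> pphi; apply: bmM; [exact: bm_muV|exact: bm_cost]. Qed.

Lemma bm_dop phi u : policies M phi -> bm u -> bm (fun x => dop x (phi x) u).
Proof.
move=> pphi bu; apply: (bmM bm_muV).
apply: (bmD (u := fun x => ev x (phi x) _)).
  by apply: bm_policy => //; exact: bm_centered.
apply: (bmM (u := fun x => mu x - 1)); last exact: bm_cst.
by apply: (bmB bm_mu); exact: bm_cst.
Qed.

(** The term [(mu x - 1) * u l] and the factor [(mu x)^-1] do not depend on the action, so a
    minimizer for the centred function serves. *)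
Lemma dop_minimizer u : bm u -> exists2 phi, policies M phi &
  forall x a, X x -> A x a ->
    dcost x (phi x) + dop x (phi x) u <= dcost x a + dop x a u.
Proof.
move=> bu; have [phi pphi phiP] := exists_minimizer qp hS (bm_centered bu).
exists phi => // x a Xx Aa; rewrite -!mulrDr ler_wpM2l//.
  by rewrite invr_ge0 ltW// mu_gt0.
by rewrite !addrA lerD2r phiP.
Qed.

(* Value iteration; the modulus of contraction is kappa, whatever beta. *)
Lemma bellman : exists2 u, bm u & exists2 phi, policies M phi &
  forall x, X x -> u x = dcost x (phi x) + dop x (phi x) u /\
    forall a, A x a -> u x <= dcost x a + dop x a u.
Proof.
have /choice[phi phiP] : forall u, exists phi, bm u -> policies M phi /\
    forall x a, X x -> A x a ->
      dcost x (phi x) + dop x (phi x) u <= dcost x a + dop x a u.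
  move=> u; have [bu|nbu] := pselect (bm u); last by exists (fun=> point).
  by have [phi] := dop_minimizer bu; exists phi.
(* Defined through a minimizing policy rather than as an infimum, [F u] is Borel at once. *)
pose F u x := dcost x (phi u x) + dop x (phi u x) u.
have bF u : bm u -> bm (F u).
  move=> bu; have [pphi _] := phiP u bu.
  by apply: (bmD (bm_dcost pphi)); exact: bm_dop.
have Fle u v D : bm u -> bm v -> (forall y, X y -> `|u y - v y| <= D) ->
    forall x, X x -> F u x - F v x <= kappa * D.
  (* The action minimizing for [v] is tested in the problem for [u], so that the costs cancel. *)
  move=> bu bv uvD x Xx; have [[_ /(_ x Xx) Av] _] := phiP v bv.
  have := (phiP u bu).2 x _ Xx Av; rewrite -/(F u x) => Fu.
  have := dop_norm_le Xx Av (bmB bu bv) uvD.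
  rewrite dopB// ler_norml => /andP[_ +].
  by move: Fu; rewrite /F; lra.
have Fcontr u v D : bm u -> bm v -> (forall y, X y -> `|u y - v y| <= D) ->
    forall x, X x -> `|F u x - F v x| <= kappa * D.
  move=> bu bv uvD x Xx; rewrite ler_norml Fle// andbT lerNl opprB Fle//.
  by move=> y Xy; rewrite distrC uvD.
pose u_ n := iter n F (cst 0).
have bu_ n : bm (u_ n) by elim: n => [|n] /=; [exact: bm_cst|exact: bF].
have [D u1D] : exists D, forall x, X x -> `|u_ 1%N x - u_ 0%N x| <= D.
  by have [_ [D uD]] := bmB (bu_ 1%N) (bu_ 0%N); exists D.
have u_D n x : X x -> `|u_ n.+1 x - u_ n x| <= kappa ^+ n * D.
  elim: n x => [|n IH] x Xx; first by rewrite expr0 mul1r; exact: u1D.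
  by rewrite exprS -mulrA /=; exact: (Fcontr _ _ _ (bu_ n.+1) (bu_ n) IH).
have /choice[u uP] : forall x, exists r, X x ->
    forall n, `|r - u_ n x| <= kappa ^+ n * (D / (1 - kappa)).
  move=> x; have [Xx|nXx] := pselect (X x); last by exists 0.
  by have [r rP] := geometric_limit kappa01 (fun n => u_D n x Xx); exists r.
have bu : bm u.
  split; last first.
    by exists (D / (1 - kappa)) => x Xx; have := uP x Xx 0%N;
      rewrite subr0 expr0 mul1r.
  apply: (@measurable_fun_cvg _ (borel S) _ _ u_) => [n|x Xx]; first exact: (bu_ n).1.
  apply/cvgrPdist_le => e e0.
  have /cvgrPdist_le/(_ e e0) := @geometric_cvg0 R kappa (D / (1 - kappa)) kappa01.
  apply: filterS => n; rewrite sub0r normrN => ne.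
  exact: le_trans (uP x Xx n) (le_trans (ler_norm _) ne).
have Fu x : X x -> F u x = u x.
  move=> Xx; apply/eqP; rewrite -subr_eq0 -normr_le0.
  (* Both [F u] and [u] are compared with [u_ n.+1], which is [F (u_ n)]; each error is at most
     [kappa ^+ n.+1 * (D / (1 - kappa))]. *)
  apply: (le_geometric0 (D := 2 * (kappa * (D / (1 - kappa)))) kappa01) => n.
  have := Fcontr _ _ _ bu (bu_ n) (fun y Xy => uP y Xy n) x Xx.
  have := uP x Xx n.+1; rewrite exprS -mulrA /=.
  have := ler_normD (F u x - F (u_ n) x) (F (u_ n) x - u x).
  rewrite addrA subrK [`|u x - _|]distrC.
  set a1 := `|_|; set a2 := `|_|; set a3 := `|_|.
  set p := kappa ^+ n * _.
  have -> : kappa ^+ n * (2 * (kappa * (D / (1 - kappa)))) = 2 * (kappa * p).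
    by rewrite /p; ring.
  by lra.
exists u => //; exists (phi u); first exact: (phiP u bu).1.
move=> x Xx; split; first by rewrite -[LHS]Fu.
by move=> a Aa; rewrite -[leLHS]Fu//; exact: (phiP u bu).2.
Qed.

(** * Borel sets of the state space with the additional point *)

Lemma measurable_setNone : measurable ([set None] : set (borel_option S)).
Proof.
apply: sub_sigma_algebra; rewrite /open_option /=.
suff -> : Some @^-1` [set None] = set0 :> set S by exact: open0.
by apply/seteqP; split.
Qed.

Lemma measurable_Some_image (B : set (borel S)) : measurable B ->
  measurable (Some @` B : set (borel_option S)).
Proof.
move: B; apply: smallest_sub.
  split => [|B mB|F mF].
  - by rewrite /= image_set0.
  - have -> : Some @` (setT `\` B) = ~` (Some @` B) `\` [set None].
      apply/seteqP; split=> [_ [y [_ nBy] <-]|[y|] [nBy ny]] /=.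
      + by split => // -[z Bz [zy]]; apply: nBy; rewrite -zy.
      + by exists y => //; split => // By; apply: nBy; exists y.
      + by case: ny.
    by apply: measurableD; [exact: measurableC|exact: measurable_setNone].
  - by rewrite /= image_bigcup; exact: bigcupT_measurable.
move=> U oU; apply: sub_sigma_algebra; rewrite /open_option /=.
suff -> : Some @^-1` (Some @` U) = U by [].
apply/seteqP; split => [y [z Uz [<-]]//|y Uy]; by exists y.
Qed.

Lemma measurable_option (B : set (borel_option S)) :
  measurable (Some @^-1` B : set (borel S)) -> measurable B.
Proof.
move=> mB; have -> : B = Some @` (Some @^-1` B) `|` (B `&` [set None]).
  apply/seteqP; split => [[y|] By|z [[y By <-]|[Bz _]]]//.
  - by left; exists y.
  - by right.
apply: measurableU; first exact: measurable_Some_image.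
have [BN|nBN] := pselect (B None).
  suff -> : B `&` [set None] = [set None] by exact: measurable_setNone.
  by apply/seteqP; split => [y []//|_ ->].
suff -> : B `&` [set None] = set0 by [].
by rewrite -subset0 => z [Bz zN]; apply: nBN; rewrite -zN.
Qed.

Lemma measurable_Some :
  measurable_fun setT (Some : borel S -> borel_option S).
Proof.
apply: (measurability (rT := borel_option S) (@open_option S)) => // _ [B oB <-].
by rewrite setTI; exact: sub_sigma_algebra.
Qed.

Lemma measurable_hvag_states :
  measurable (hvag_states M : set (borel_option S)).
Proof.
apply: measurable_option; rewrite /hvag_states.
suff -> : Some @^-1` (Some @` X `|` [set None]) = X by [].
by apply/seteqP; split => [y [[z Xz [<-]]|]//|y Xy]; left; exists y.
Qed.

Lemma measurable_fun_option (u : option S -> \bar R) (g : S -> R) : bm g ->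
  (forall y, X y -> u (Some y) = (g y)%:E) ->
  measurable_fun (hvag_states M : set (borel_option S))
    (u : borel_option S -> \bar R).
Proof.
move=> [mg _] ug _ B mB; apply: measurable_option.
have /measurable_EFinP/(_ mX B mB) := mg; congr measurable.
apply/seteqP; split => y /=.
  by move=> [Xy Bgy]; rewrite ug//; split => //; left; exists y.
by move=> [[[z Xz [<-]]|//] Buz]; rewrite -ug.
Qed.

(** * The transformed transition probabilities and the discounted value *)

Section hvag.
Variable beta : R.
Hypothesis beta_ge : kappa <= beta.
Local Open Scope ereal_scope.

Let beta_ge0 : (0 <= beta)%R.
Proof. by have /andP[k0 _] := kappa01; exact: le_trans k0 beta_ge. Qed.

Section fixed.
Variables (x : S) (a : T).
Hypotheses (Xx : X x) (Aa : A x a).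

Let r := ((beta * mu x)^-1)%R.
Let s := (mu x - 1 - ev x a (off_l mu))%R.
Let t := (1 - r * (mu x - 1))%R.

Let r0 : (0 <= r)%R. Proof. by rewrite invr_ge0 mulr_ge0// ltW// mu_gt0. Qed.
Let s0 : (0 <= s)%R. Proof. by have /andP[_] := ev_off_mu Xx Aa; rewrite subr_ge0. Qed.
(** The mass sent to the additional state is nonnegative because
    [(mu x - 1) / mu x <= kappa <= beta]. For [beta = 0] the inverse [r] is 0 and this mass is 1. *)
Let t0 : (0 <= t)%R.
Proof.
rewrite subr_ge0 /r; have [->|b0] := eqVneq beta 0%R.
  by rewrite mul0r invr0 mul0r.
have bgt0 : (0 < beta)%R by rewrite lt_neqAle eq_sym b0.
rewrite mulrC ler_pdivrMr ?mulr_gt0 ?mu_gt0// mul1r -ler_pdivrMr ?mu_gt0//.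
apply: le_trans beta_ge; rewrite /kappa !mulrBl !divff ?gt_eqF ?mu_gt0//.
by rewrite lerD2l lerN2 !mul1r lef_pV2 ?posrE ?mu_gt0// mu_leK.
Qed.

(** [hvag_trans] is a bare set function; identifying it with the sum of a weighted image measure and
    two point masses opens it to integration theory. *)
Lemma hvag_measure : exists nu : {measure set (borel_option S) -> \bar R},
  hvag_trans M l mu beta (Some x) (Some a) = nu /\
  forall u : borel_option S -> \bar R, measurable_fun setT u ->
    (forall z, 0 <= u z) ->
    \int[nu]_z u z =
      r%:E * (\int[trans M x a]_(y in X) (u (Some y) * (off_l mu y)%:E)) +
      (r * s)%:E * u (Some l) + t%:E * u None.
Proof.
pose f : borel S -> R := off_l mu \_ X.
have mf : measurable_fun setT f.
  by apply/(measurable_restrictT _ mX); have [] := bm_off_l bm_mu.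
have f0 y : (0 <= f y)%R.
  rewrite /f patchE; case: ifPn => // /set_mem Xy.
  have [->|/eqP yl] := eqVneq y l; first by rewrite off_l_eq.
  by rewrite off_l_neq// ltW// mu_gt0.
have [nu [nuE nuI]] :=
  exists_pushforward_density (trans M x a) measurable_Some mf f0.
pose dl : {measure set (borel_option S) -> \bar R} := \d_(Some l : borel_option S).
pose dN : {measure set (borel_option S) -> \bar R} := \d_(None : borel_option S).
pose m1 : {measure set (borel_option S) -> \bar R} := mscale (NngNum r0) nu.
pose m2 : {measure set (borel_option S) -> \bar R} :=
  mscale (NngNum (mulr_ge0 r0 s0)) dl.
pose m3 : {measure set (borel_option S) -> \bar R} := mscale (NngNum t0) dN.
pose m12 : {measure set (borel_option S) -> \bar R} := measure_add m1 m2.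
exists (measure_add m12 m3); split.
  apply/funext => B; transitivity (m12 B + m3 B); last first.
    by symmetry; exact: measure_addE.
  have -> : m12 B = m1 B + m2 B by exact: measure_addE.
  rewrite /m1 /m2 /m3 /= /mscale /= nuE.
  congr (_ * _ + _ * _ + _ * _).
    rewrite [LHS]integral_mkcond [RHS]integral_mkcond.
    apply: eq_integral => y _; rewrite !patchE /f patchE setDE !in_setI.
    rewrite -[[set _ | _]]/(Some @^-1` B) /off_l /= indicE.
    by case: (y \in Some @^-1` B) => //=; case: (y \in X) => //=;
      case: (y \in _); rewrite ?mulr1 ?mulr0.
  by rewrite integral_off_l// -?EFinB -?EFinM//; exact: bm_mu.
move=> u mu_ u0.
rewrite ge0_integral_measure_add// ge0_integral_measure_add//.
rewrite !ge0_integral_mscale//= nuI//.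
rewrite !integral_dirac// !diracT !mul1e.
congr (_ * _ + _ + _).
rewrite [RHS]integral_mkcond; apply: eq_integral => y _.
by rewrite /f !patchE; case: ifP => _ //; rewrite mule0.
Qed.

Lemma hvag_int_ge0E (u : option S -> \bar R) (g : S -> R) : bm g ->
  (forall y, X y -> (0 <= g y)%R) -> (forall y, X y -> u (Some y) = (g y)%:E) ->
  u None = 0 ->
  hvag_int M l mu beta u (Some x) (Some a) = (beta^-1 * dop x a g)%:E.
Proof.
move=> bg g0 ug uN; have [nu [nuE nuI]] := hvag_measure.
rewrite /hvag_int nuE integral_mkcond; set w := u \_ _.
have wS y : X y -> w (Some y) = (g y)%:E.
  by move=> Xy; rewrite /w patchE mem_set ?ug//; left; exists y.
have wN : w None = 0 by rewrite /w patchE uN; case: ifP.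
have wX y : ~ X y -> w (Some y) = 0.
  by move=> nXy; rewrite /w patchE memNset// => -[[z Xz [zy]]|//];
    apply: nXy; rewrite -zy.
have mw : measurable_fun setT (w : borel_option S -> \bar R).
  apply/(measurable_restrictT _ measurable_hvag_states).
  exact: measurable_fun_option bg ug.
have w0 z : 0 <= w z.
  case: z => [y|]; last by rewrite wN.
  have [Xy|nXy] := pselect (X y); last by rewrite wX.
  by rewrite wS// lee_fin g0.
rewrite nuI// wN mule0 adde0 wS//.
have -> : \int[trans M x a]_(y in X) (w (Some y) * (off_l mu y)%:E) =
    (ev x a (off_l (g \* mu)))%:E.
  rewrite -EFin_ev//; last exact: (bm_off_l (bmM bg bm_mu)).
  apply: eq_integral => y /set_mem Xy; rewrite wS// -EFinM /off_l /=.
  by rewrite mulrA.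
rewrite -!EFinM -EFinD dopE// /r /s invfM; congr (_%:E).
by ring.
Qed.

Lemma hvag_intE (u : option S -> \bar R) (g : S -> R) : bm g ->
  (forall y, X y -> u (Some y) = (g y)%:E) -> u None = 0 ->
  hvag_int M l mu beta u (Some x) (Some a) = (beta^-1 * dop x a g)%:E.
Proof.
move=> bg ug uN; have [nu [nuE _]] := hvag_measure.
pose gp y := Num.max (g y) 0%R; pose gn y := Num.max (- g y)%R 0%R.
have bgp : bm gp.
  have [mg [C gC]] := bg; split; first exact: measurable_maxr.
  exists C => y /gC; rewrite /gp; case: (leP (g y) 0%R) => // _.
  by rewrite normr0; exact: le_trans.
have bgn : bm gn.
  have [mg [C gC]] := bg; split.
    by apply: measurable_maxr => //; exact: measurable_funN.
  exists C => y /gC; rewrite /gn; case: (leP (- g y)%R 0%R) => // _.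
    by rewrite normr0; exact: le_trans.
  by rewrite normrN.
have := integralE nu (hvag_states M) u.
have -> : \int[nu]_(z in hvag_states M) u^\+ z =
    hvag_int M l mu beta u^\+ (Some x) (Some a) by rewrite /hvag_int nuE.
have -> : \int[nu]_(z in hvag_states M) u^\- z =
    hvag_int M l mu beta u^\- (Some x) (Some a) by rewrite /hvag_int nuE.
rewrite (@hvag_int_ge0E _ gp)//; last 3 first.
- by move=> y _; rewrite le_max lexx orbT.
- by move=> y Xy; rewrite funeposE ug// -EFin_max.
- by rewrite funeposE uN maxxx.
rewrite (@hvag_int_ge0E _ gn)//; last 3 first.
- by move=> y _; rewrite le_max lexx orbT.
- by move=> y Xy; rewrite funenegE ug// -EFinN -EFin_max.
- by rewrite funenegE uN oppe0 maxxx.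
rewrite /hvag_int nuE => ->; rewrite -EFinB -mulrBr -dopB//.
congr (_ * _)%:E; apply: eq_dop => y _ /=; rewrite /gp /gn.
by case: (leP (g y) 0%R) => gy; case: (leP (- g y)%R 0%R) => gy' //; lra.
Qed.

(* In case beta = 0, [kappa = 0] and both sides vanish. *)
Lemma mul_beta_dop (g : S -> R) : bm g ->
  (beta * (beta^-1 * dop x a g) = dop x a g)%R.
Proof.
move=> bg; have [b0|b0] := eqVneq beta 0%R; last by rewrite mulrA divff// mul1r.
rewrite b0 mul0r; have [_ [C gC]] := bg.
have := dop_norm_le Xx Aa bg gC.
have -> : kappa = 0%R.
  by apply/eqP; rewrite eq_le -[X in (_ <= X)%R]b0 beta_ge/=; have /andP[] := kappa01.
by rewrite mul0r normr_le0 => /eqP.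
Qed.

End fixed.

(** The [n]-th term of the discounted series, with [beta ^+ n] already cancelled; see
    [discounted_term]. *)
Definition dsum phi n : S -> R :=
  iter n (fun u x => dop x (phi x) u) (fun x => dcost x (phi x)).

Lemma bm_dsum phi n : policies M phi -> bm (dsum phi n).
Proof.
move=> pphi; elim: n => [|n IH] /=; first exact: bm_dcost.
exact: (bm_dop pphi IH).
Qed.

Lemma iter_hvag_op phi n : policies M phi ->
  let v := iter n (hvag_op M l mu beta phi) (hvag_cost_of M mu phi) in
  (forall x, X x -> v (Some x) = ((beta^-1) ^+ n * dsum phi n x)%:E) /\
  v None = 0.
Proof.
move=> pphi; elim: n => [|n [IH IHN]] /=.
  by split => // y Xy; rewrite expr0 mul1r.
have bg : bm (fun z => (beta^-1) ^+ n * dsum phi n z)%R.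
  by apply: bmZ; exact: bm_dsum.
split=> [y Xy|]; rewrite {1}/hvag_op /=.
  rewrite (@hvag_intE _ _ Xy (pphi.2 y Xy) _ _ bg)//.
  by rewrite dopZ//; [rewrite mulrA -exprS|exact: pphi.2|exact: bm_dsum].
have mv := measurable_fun_option bg IH.
have := integral_dirac (None : borel_option S) measurable_hvag_states mv.
by rewrite IHN mule0.
Qed.

Lemma discounted_term phi n x : policies M phi -> X x ->
  (beta ^+ n)%:E * iter n (hvag_op M l mu beta phi) (hvag_cost_of M mu phi)
    (Some x) = (dsum phi n x)%:E.
Proof.
move=> pphi Xx; rewrite (iter_hvag_op n pphi).1// -EFinM.
case: n => [|n]; first by rewrite !expr0 !mul1r.
have [b0|b0] := eqVneq beta 0%R; last first.
  by rewrite exprVn mulrA divff ?mul1r// expf_neq0.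
(* For [beta = 0] this says that the [dop] in question vanishes, so both sides of the goal are 0. *)
have := mul_beta_dop Xx (pphi.2 x Xx) (bm_dsum n pphi).
by rewrite b0 /= => <-; rewrite expr0n /= !mul0r.
Qed.

Local Open Scope ring_scope.

Lemma iter_dop_norm_le phi (u : S -> R) C : policies M phi -> bm u ->
  (forall x, X x -> `|u x| <= C) ->
  forall n, bm (iter n (fun w x => dop x (phi x) w) u) /\
    forall x, X x -> `|iter n (fun w x => dop x (phi x) w) u x| <= kappa ^+ n * C.
Proof.
move=> pphi bu uC; elim=> [|n [bn IH]].
  by split => // x Xx; rewrite expr0 mul1r uC.
split; first exact: (bm_dop pphi bn).
by move=> x Xx; rewrite exprS -mulrA /=; apply: dop_norm_le => //; exact: pphi.2.
Qed.

Lemma hvag_total_costE phi x : policies M phi -> X x ->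
  exists s C : R, hvag_total_cost M l mu beta phi (Some x) = s%:E /\
    forall n, `|s - \sum_(0 <= k < n) dsum phi k x| <= kappa ^+ n * C.
Proof.
move=> pphi Xx; have [_ [C cC]] := bm_dcost pphi.
have dC := iter_dop_norm_le pphi (bm_dcost pphi) cC.
have [|s sP] := @geometric_limit R
  (fun n => \sum_(0 <= k < n) dsum phi k x) kappa C kappa01.
  by move=> n; rewrite /= big_nat_recr//= addrAC subrr add0r; exact: (dC n).2.
exists s, (C / (1 - kappa)); split => //.
apply/cvg_lim => //.
rewrite [X in X @ _ --> _](_ : _ = EFin \o (fun n => \sum_(0 <= k < n) dsum phi k x)).
  apply: cvg_EFin; first exact: nearW.
  apply/cvgrPdist_le => e e0.
  have /cvgrPdist_le/(_ e e0) := @geometric_cvg0 R kappa (C / (1 - kappa)) kappa01.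
  apply: filterS => n; rewrite sub0r normrN => ne.
  exact: le_trans (sP n) (le_trans (ler_norm _) ne).
apply/funext => n /=; rewrite -sumEFin; apply: eq_bigr => k _.
exact: discounted_term.
Qed.

Section value.
Variables (u : S -> R) (phi0 : S -> T).
Hypothesis bu : bm u.
Hypothesis pphi0 : policies M phi0.
Hypothesis u_le : forall x a, X x -> A x a -> u x <= dcost x a + dop x a u.
Hypothesis u_eq : forall x, X x -> u x = dcost x (phi0 x) + dop x (phi0 x) u.

Let it phi n := iter n (fun w x => dop x (phi x) w) u.

Let bm_it phi n : policies M phi -> bm (it phi n).
Proof. by move=> pphi; elim: n => //= n; exact: bm_dop. Qed.

(** The Bellman inequality, propagated by monotonicity of [dop]. Its sum over [n] telescopes, and
    the remainder [it phi n] decays like [kappa ^+ n]. *)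
Let it_le phi n x : policies M phi -> X x ->
  it phi n x - it phi n.+1 x <= dsum phi n x.
Proof.
move=> pphi; elim: n x => [|n IH] x Xx.
  by rewrite /= lerBlDr; apply: u_le => //; exact: pphi.2.
have Ax : A x (phi x) by exact: pphi.2.
rewrite /= -dopB//; [|exact: bm_it|exact: (@bm_it phi n.+1)].
apply: dop_le => //; first by apply: bmB; [exact: bm_it|exact: (@bm_it phi n.+1)].
exact: bm_dsum.
Qed.

Let it_eq n x : X x -> it phi0 n x - it phi0 n.+1 x = dsum phi0 n x.
Proof.
elim: n x => [|n IH] x Xx; first by rewrite /= [X in X - _]u_eq// addrK.
have Ax : A x (phi0 x) by exact: pphi0.2.
rewrite /= -dopB//; [|exact: bm_it|exact: (@bm_it phi0 n.+1)].
exact: eq_dop.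
Qed.

Let sum_it phi n x :
  \sum_(0 <= k < n) (it phi k x - it phi k.+1 x) = u x - it phi n x.
Proof.
elim: n => [|n IH]; first by rewrite big_nil subrr.
by rewrite big_nat_recr//= IH addrA subrK.
Qed.

Lemma le_hvag_total_cost phi x : policies M phi -> X x ->
  ((u x)%:E <= hvag_total_cost M l mu beta phi (Some x))%E.
Proof.
move=> pphi Xx; have [s [C [-> sC]]] := hvag_total_costE pphi Xx.
have [_ [D uD]] := bu; have itD := iter_dop_norm_le pphi bu uD.
rewrite lee_fin -subr_le0; apply: (@le_geometric0 R kappa (D + C) _ kappa01) => n.
have := sC n; have := (itD n).2 x Xx; rewrite -/(it phi n x) mulrDr.
have : u x - it phi n x <= \sum_(0 <= k < n) dsum phi k x.
  by rewrite -sum_it; apply: ler_sum_nat => k _; exact: it_le.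
by rewrite !ler_norml => + /andP[_ +] /andP[+ _]; lra.
Qed.

Lemma hvag_total_cost_opt x : X x ->
  hvag_total_cost M l mu beta phi0 (Some x) = (u x)%:E.
Proof.
move=> Xx; apply/eqP; rewrite eq_le le_hvag_total_cost// andbT.
have [s [C [-> sC]]] := hvag_total_costE pphi0 Xx.
have [_ [D uD]] := bu; have itD := iter_dop_norm_le pphi0 bu uD.
rewrite lee_fin -subr_le0; apply: (@le_geometric0 R kappa (D + C) _ kappa01) => n.
have := sC n; have := (itD n).2 x Xx; rewrite -/(it phi0 n x) mulrDr.
have : u x - it phi0 n x = \sum_(0 <= k < n) dsum phi0 k x.
  by rewrite -sum_it; apply: eq_big_nat => k _; exact: it_eq.
by rewrite !ler_norml => + /andP[+ _] /andP[_ +]; lra.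
Qed.

Lemma hvag_valueE x : X x -> hvag_value M l mu beta (Some x) = (u x)%:E.
Proof.
move=> Xx; apply/eqP; rewrite eq_le; apply/andP; split.
  by apply: ereal_inf_lbound; exists phi0 => //; exact: hvag_total_cost_opt.
by apply: le_ereal_inf_tmp => _ [phi pphi <-]; exact: le_hvag_total_cost.
Qed.

Lemma hvag_value_None : hvag_value M l mu beta None = 0%E.
Proof.
have tot0 phi : policies M phi -> hvag_total_cost M l mu beta phi None = 0%E.
  move=> pphi; apply/cvg_lim => //.
  rewrite [X in X @ _ --> _](_ : _ = cst 0%E); first exact: cvg_cst.
  apply/funext => n; apply: big1 => k _.
  by rewrite (iter_hvag_op k pphi).2 mule0.
apply/eqP; rewrite eq_le; apply/andP; split.
  by apply: ereal_inf_lbound; exists phi0 => //; exact: tot0.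
by apply: le_ereal_inf_tmp => _ [phi pphi <-]; rewrite tot0.
Qed.

(** * Average cost *)

Let hr : S -> R := fun y => (u y - u l) * mu y.

Let bm_hr : bm hr. Proof. exact: bm_centered. Qed.

(** The pivot between the two models: their optimality gaps differ by the factor [mu x]. As it is
    positive, inequalities, equalities and minimizing actions transfer. *)
Lemma acoe_gap x a : X x -> A x a ->
  c x a + ev x a hr - (u l + hr x) = mu x * (dcost x a + dop x a u - u x).
Proof.
move=> Xx Aa; rewrite /dcost /dop -/hr mulrBr mulrDr !mulrA mulfV ?gt_eqF ?mu_gt0//.
by rewrite !mul1r /hr; ring.
Qed.

Lemma acoe_le x a : X x -> A x a -> u l + hr x <= c x a + ev x a hr.
Proof.
move=> Xx Aa; rewrite -subr_ge0 acoe_gap// mulr_ge0 ?subr_ge0 ?u_le//.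
by rewrite ltW// mu_gt0.
Qed.

Lemma acoe_eqP x a : X x -> A x a ->
  u l + hr x = c x a + ev x a hr <-> u x = dcost x a + dop x a u.
Proof.
move=> Xx Aa; have gap := acoe_gap Xx Aa; split => E.
  move: gap; rewrite E subrr => /esym/eqP; rewrite mulf_eq0 gt_eqF ?mu_gt0//=.
  by rewrite subr_eq0 => /eqP.
by move: gap; rewrite -E subrr mulr0 => /eqP; rewrite subr_eq0 => /eqP.
Qed.

Let cit phi n : S -> R := iter n (fun g x => ev x (phi x) g) (fun x => c x (phi x)).
Let hit phi n : S -> R := iter n (fun g x => ev x (phi x) g) hr.

Let bm_cit phi n : policies M phi -> bm (cit phi n).
Proof.
by move=> pphi; elim: n => [|n IH] /=; [exact: bm_cost|exact: bm_policy].
Qed.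

Let bm_hit phi n : policies M phi -> bm (hit phi n).
Proof. by move=> pphi; elim: n => [|n IH] //=; exact: bm_policy. Qed.

Let hit_bounded phi : policies M phi ->
  exists D, forall n x, X x -> `|hit phi n x| <= D.
Proof.
move=> pphi; have [_ [D hD]] := bm_hr; exists D; elim=> [|n IH] x Xx; first exact: hD.
by apply: ev_norm_le => //; [exact: pphi.2|exact: bm_hit].
Qed.

(** Iterates [acoe_le]: transition probabilities have mass 1, so the constant [u l] is reproduced at
    every step, while the terms in [hit] telescope when summed. *)
Let cit_le phi n x : policies M phi -> X x ->
  u l + (hit phi n x - hit phi n.+1 x) <= cit phi n x.
Proof.
move=> pphi; elim: n x => [|n IH] x Xx.
  by rewrite /= addrA lerBlDr; apply: acoe_le => //; exact: pphi.2.
have Ax : A x (phi x) by exact: pphi.2.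
have bd : bm (hit phi n \- hit phi n.+1).
  by apply: bmB; [exact: bm_hit|exact: (@bm_hit phi n.+1)].
rewrite /= -evB//; [|exact: bm_hit|exact: (@bm_hit phi n.+1)].
rewrite -[X in X + _](ev_cst qp Xx Ax) -evD//; last exact: bm_cst.
apply: ev_le => //; [by apply: bmD => //; exact: bm_cst|exact: bm_cit].
Qed.

Let cit_eq phi n x : policies M phi ->
  (forall y, X y -> u l + hr y = c y (phi y) + ev y (phi y) hr) -> X x ->
  u l + (hit phi n x - hit phi n.+1 x) = cit phi n x.
Proof.
move=> pphi hphi; elim: n x => [|n IH] x Xx.
  by rewrite /= addrA [X in X - _]hphi// addrK.
have Ax : A x (phi x) by exact: pphi.2.
have bd : bm (hit phi n \- hit phi n.+1).
  by apply: bmB; [exact: bm_hit|exact: (@bm_hit phi n.+1)].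
rewrite /= -evB//; [|exact: bm_hit|exact: (@bm_hit phi n.+1)].
rewrite -[X in X + _](ev_cst qp Xx Ax) -evD//; last exact: bm_cst.
exact: eq_ev.
Qed.

Let sum_hit phi n x :
  \sum_(0 <= k < n) (u l + (hit phi k x - hit phi k.+1 x)) =
  n%:R * u l + (hr x - hit phi n x).
Proof.
elim: n => [|n IH]; first by rewrite big_nil mul0r subrr addr0.
by rewrite big_nat_recr//= IH -natr1; ring.
Qed.

Let avg_costE phi x : policies M phi -> X x ->
  avg_cost M phi x =
  limn_esup (fun N => (N%:R^-1 * \sum_(0 <= n < N) cit phi n x)%:E).
Proof.
move=> pphi Xx; rewrite /avg_cost; congr (limn_esup _); apply/funext => N.
rewrite EFinM -sumEFin; congr (_ * _)%E; apply: eq_bigr => n _.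
suff : forall y, X y -> iter n (op M phi) (cost_of M phi) y = (cit phi n y)%:E by exact.
elim: n => [//|n IH] y Xy; rewrite iterS {1}/op.
rewrite -(EFin_ev qp Xy (pphi.2 y Xy) (bm_cit n pphi)).
by apply: eq_integral => z /set_mem; exact: IH.
Qed.

Let cvg_invn_mul (D : R) : N%:R^-1 * D @[N --> \oo] --> (0 : R).
Proof.
rewrite -[X in _ --> X](mul0r D); apply: cvgMl.
by rewrite -cvg_shiftS; exact: cvg_harmonic.
Qed.

Lemma avg_cost_ge phi x : policies M phi -> X x ->
  ((u l)%:E <= avg_cost M phi x)%E.
Proof.
move=> pphi Xx; rewrite avg_costE// limn_esup_lim.
have [D hD] := hit_bounded pphi.
apply: lime_ge; first exact: is_cvg_esups.
apply: nearW => n; set a := (X in esups X).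
have blim : (u l - N%:R^-1 * (2 * D))%:E @[N --> \oo] --> (u l)%:E.
  apply: cvg_EFin; first exact: nearW.
  rewrite -[X in _ --> X]subr0; apply: cvgB; first exact: cvg_cst.
  exact: cvg_invn_mul.
(* Taking [N > n] keeps [N] in the tail that starts at [n] and makes it positive, so that division
   by [N] makes sense. *)
apply: cvge_le blim; exists n.+1 => // N /= nN.
apply: (@le_trans _ _ (a N)); last first.
  by apply: ereal_sup_ubound; exists N => //=; exact: ltnW.
have N0 : 0 < N%:R :> R by rewrite ltr0n (leq_trans _ nN).
rewrite /a lee_fin -[u l](mulKf (lt0r_neq0 N0)) -mulrBr ler_pM2l ?invr_gt0//.
apply: (@le_trans _ _ (N%:R * u l + (hr x - hit phi N x))).
  rewrite lerD2l; have := hD 0%N x Xx; have := hD N x Xx.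
  rewrite /hit /= !ler_norml.
  by move=> /andP[_ +] /andP[+ _]; lra.
by rewrite -sum_hit; apply: ler_sum_nat => k _; exact: cit_le.
Qed.

(** Equality at every step leaves only the boundary terms, bounded by [2 * D], so the averages
    converge and the upper limit is a limit. *)
Lemma avg_cost_eq phi x : policies M phi ->
  (forall y, X y -> u l + hr y = c y (phi y) + ev y (phi y) hr) -> X x ->
  avg_cost M phi x = (u l)%:E.
Proof.
move=> pphi hphi Xx; rewrite avg_costE//; apply: (cvg_limn_einf_sup _).2.
have [D hD] := hit_bounded pphi.
apply: cvg_EFin; first exact: nearW.
apply/cvgrPdist_le => e e0.
have /cvgrPdist_le/(_ e e0) := cvg_invn_mul (2 * D).
move=> [m _ mP]; exists m.+1 => // N /= mN.
have N0 : 0 < N%:R :> R by rewrite ltr0n (leq_trans _ mN).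
apply: le_trans (mP N (ltnW mN)); rewrite sub0r normrN.
rewrite -[u l](mulKf (lt0r_neq0 N0)) -mulrBr !normrM ler_wpM2l//.
have -> : \sum_(0 <= n < N) cit phi n x = N%:R * u l + (hr x - hit phi N x).
  by rewrite -sum_hit; apply: eq_big_nat => k _; rewrite cit_eq.
rewrite opprD addrA subrr sub0r normrN.
rewrite -normrM; apply: (@le_trans _ _ (2 * D)); last exact: ler_norm.
apply: le_trans (ler_normB _ _) _.
by rewrite mulr_natl mulr2n lerD// ?hD//; exact: (hD 0%N).
Qed.

End value.
End hvag.
End discount.

(** * Transfer of the real-valued identities to the extended-real model *)

Local Open Scope ereal_scope.

Theorem theorem21 (R : realType) (S T : completeMetricType R)
  (M : borel_mdp S T)
  (q_prob : transition_probabilities M)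
  (hS : assumptionS M)
  (c_bounded : bounded_cost M)
  (l : S) (l_state : states M l) (K : R)
  (hK : forall phi, policies M phi ->
    kernel_norm M (fun x B => \sum_(0 <= n <oo) taboo_kernel M l phi n x B)
      <= K%:E)
  (mu : S -> R)
  (mu_meas : measurable_fun (states M : set (borel S)) (mu : borel S -> R))
  (mu_ge1 : forall x, states M x -> (1 <= mu x)%R)
  (mu_leK : forall x, states M x -> (mu x <= K)%R)
  (hmu : forall x a, states M x -> act M x a ->
    1 + \int[trans M x a]_(y in states M `\ l) (mu y)%:E <= (mu x)%:E)
  (beta : R) (beta_ge : ((K - 1) / K <= beta)%R) (beta_lt1 : (beta < 1)%R) :
  let v := hvag_value M l mu beta in
  let w := v (Some l) in
  let h := fun x => (mu x)%:E * (v (Some x) - w) in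
  (* w and h are real-valued and the integrals of h exist *)
  ((forall x, hvag_states M x -> v x \is a fin_num) /\
   (forall x a, states M x -> act M x a ->
      (trans M x a).-integrable (states M) h)) /\
  (* (i) *)
  ((forall x, states M x ->
      (exists2 a, act M x a & w + h x = avg_rhs M h x a) /\
      (forall a, act M x a -> w + h x <= avg_rhs M h x a)) /\
   (forall x, states M x -> opt_avg_cost M x = w)) /\
  (* (ii) *)
  [/\ (exists2 phi, policies M phi &
        forall x, states M x -> avg_argmin M w h x (phi x)),
      (forall x, states M x ->
        avg_argmin M w h x = hvag_argmin M l mu beta x) &
      (forall phi, policies M phi ->
        (forall x, states M x -> avg_argmin M w h x (phi x)) ->
        avg_optimal M phi)].
Proof.
move=> v w h.
have [u bu [phi pphi uP]] :=
  bellman q_prob hS c_bounded l_state mu_meas mu_ge1 mu_leK hmu.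
have u_le x a : states M x -> act M x a ->
    (u x <= dcost M mu x a + dop M l mu x a u)%R.
  by move=> Xx Aa; exact: (uP x Xx).2.
have u_eq x : states M x ->
    u x = (dcost M mu x (phi x) + dop M l mu x (phi x) u)%R.
  by move=> Xx; exact: (uP x Xx).1.
have vE x : states M x -> v (Some x) = (u x)%:E.
  exact: (hvag_valueE q_prob c_bounded l_state mu_meas mu_ge1 mu_leK hmu
    beta_ge bu pphi u_le u_eq).
have vN : v None = 0.
  exact: (hvag_value_None q_prob c_bounded l_state mu_meas mu_ge1 mu_leK hmu
    beta_ge pphi).
pose hr y := ((u y - u l) * mu y)%R.
have bm_hr : bounded_measurable M hr.
  exact: (bm_centered l mu_meas mu_ge1 mu_leK bu).
have hE x : states M x -> h x = (hr x)%:E.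
  by move=> Xx; rewrite /h /w !vE// -EFinB -EFinM mulrC.
have whE x : states M x -> w + h x = (u l + hr x)%:E.
  by move=> Xx; rewrite /w vE// hE.
have rhsE x a : states M x -> act M x a ->
    avg_rhs M h x a = (cost M x a + ev M x a hr)%:E.
  move=> Xx Aa; rewrite /avg_rhs EFinD -(EFin_ev q_prob Xx Aa bm_hr).
  by congr (_ + _); apply: eq_integral => y /set_mem/hE.
(* Both descriptions of the optimal actions reduce to equality in the Bellman equation of the
   discounted model. *)
have argminE x a : states M x -> act M x a ->
    w + h x = avg_rhs M h x a <->
    u x = (dcost M mu x a + dop M l mu x a u)%R.
  move=> Xx Aa; rewrite whE// rhsE// -(acoe_eqP l mu_ge1 u Xx Aa).
  by split => E; [exact: EFin_inj E|congr EFin].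
have hvagE x a : states M x -> act M x a ->
    (hvag_cost M mu (Some x) (Some a))%:E +
      beta%:E * hvag_int M l mu beta v (Some x) (Some a) =
    (dcost M mu x a + dop M l mu x a u)%:E.
  move=> Xx Aa; rewrite (hvag_intE q_prob l_state mu_meas mu_ge1 mu_leK hmu
    beta_ge Xx Aa bu vE vN) -EFinM -EFinD.
  by rewrite (mul_beta_dop q_prob l_state mu_meas mu_ge1 mu_leK hmu beta_ge Xx Aa
    bu).
have argmin_cost psi : policies M psi ->
    (forall x, states M x -> avg_argmin M w h x (psi x)) ->
    forall x, states M x -> avg_cost M psi x = w.
  move=> ppsi psiP x Xx; rewrite /w vE//; 
  apply: (avg_cost_eq q_prob c_bounded mu_meas mu_ge1 mu_leK bu) => // y Xy.
  have [Ay] := psiP y Xy; rewrite whE// rhsE//; exact: EFin_inj.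
have phiP x : states M x -> avg_argmin M w h x (phi x).
  move=> Xx; have Ax := pphi.2 x Xx; split => //; apply/argminE => //.
  exact: u_eq.
have optE x : states M x -> opt_avg_cost M x = w.
  move=> Xx; apply/eqP; rewrite eq_le; apply/andP; split.
    by apply: ereal_inf_lbound; exists phi => //; exact: argmin_cost.
  apply: le_ereal_inf_tmp => _ [psi ppsi <-]; rewrite /w vE//.
  
  exact: (avg_cost_ge q_prob c_bounded mu_meas mu_ge1 mu_leK bu u_le).
split; [split|split; [split|split]] => //.
- by move=> _ [[x Xx <-]| ->]; rewrite ?vE ?vN.
- move=> x a Xx Aa; have := bm_integrable q_prob Xx Aa bm_hr.
  apply: eq_integrable; first exact: measurable_states.
  by move=> y /set_mem/hE.
- move=> x Xx; split.
    by exists (phi x); [exact: pphi.2|have [] := phiP x Xx].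
  by move=> a Aa; rewrite whE// rhsE// lee_fin; exact: (acoe_le mu_ge1 u_le).
- by exists phi.
- move=> x Xx; apply/seteqP; split => a [Aa E].
    by split=> //; rewrite -/v hvagE// vE//; congr EFin; apply/argminE.
  split => //; apply/argminE => //; apply: EFin_inj.
  by move: E; rewrite -/v hvagE// vE.
- move=> psi ppsi psiP; split => // x Xx.
  by rewrite (argmin_cost psi)// optE.
Qed.
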